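(* Let $m\ge 1$ and $n\ge 1$ be integers, let $H$ be a complex Hilbert space, and let $T=(T_1,\ldots,T_n)\in L(H)^n$ be a commuting row contraction that is regular at $z=0$. Then $T$ satisfies the operator identity \[ (T^*T)^{-1}=\Big(\oplus\sum_{j=0}^{m-1}(-1)^j\binom{m}{j+1}\sigma_T^j(1_H)\Big)\Big|\,\mathrm{Im}\,T^* \] if and only if $T=T_0\oplus T_1\in L(H_0\oplus H_1)^n$ is the (orthogonal) direct sum of a spherical coisometry $T_0\in L(H_0)^n$ and a commuting tuple $T_1\in L(H_1)^n$ which is unitarily equivalent to $M_z\in L(H_m(\mathbb B,\mathcal D))^n$ for some Hilbert space $\mathcal D$.
   Context: $L(H)$ is the algebra of bounded linear operators on $H$. All Hilbert spaces are complex; the spaces $H_0,H_1,\mathcal D$ are allowed to be $\{0\}$. For a commuting tuple $T\in L(H)^n$, the same letter $T$ denotes the row operator $T:H^n\to H$, $(h_i)_{i=1}^n\mapsto\sum_{i=1}^n T_ih_i$, with adjoint $T^*:H\to H^n$, $h\mapsto(T_i^*h)_{i=1}^n$. $T$ is a row contraction if the row operator is a contraction, i.e. $\sum_i T_iT_i^*\le 1_H$. If $TH^n=\sum_i T_iH$ is closed, put $W(T)=H\ominus\sum_{i=1}^nT_iH$. For $z\in\mathbb C^n$, $Z:H^n\to H$ is the row operator $(h_i)\mapsto\sum_i z_ih_i$, and $\|z\|$ is the Euclidean norm. $T$ is regular at $z=0$ if $TH^n\subset H$ is closed and there is $\epsilon>0$ such that for all $z\in\mathbb C^n$ with $\|z\|<\epsilon$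 the subspace $(T-Z)H^n\subset H$ is closed and $H$ is the algebraic direct sum $H=(T-Z)H^n\oplus W(T)$. Since $TH^n$ is closed, $T^*T:\mathrm{Im}\,T^*\to\mathrm{Im}\,T^*$ is invertible, and $(T^*T)^{-1}$ denotes its inverse. $\sigma_T:L(H)\to L(H)$ is the map $\sigma_T(X)=\sum_{i=1}^nT_iXT_i^*$, $\sigma_T^j$ is its $j$-th iterate, and for $X\in L(H)$, $\oplus X\in L(H^n)$ is the operator $(h_i)_i\mapsto(Xh_i)_i$. The operator identity means that both sides agree at every vector of $\mathrm{Im}\,T^*\subset H^n$. A spherical coisometry is a commuting tuple $S\in L(H_0)^n$ with $\sum_{i=1}^nS_iS_i^*=1_{H_0}$. $\mathbb B\subset\mathbb C^n$ is the open Euclidean unit ball. $H_m(\mathbb B,\mathcal D)$ is the $\mathcal D$-valued analytic functional Hilbert space on $\mathbb B$ with reproducing kernel $(z,w)\mapsto(1-\langle z,w\rangle)^{-m}1_{\mathcal D}$; equivalently the space of all analytic $f=\sum_{\alpha\in\mathbb N^n}f_\alpha z^\alpha:\mathbb B\to\mathcal D$ with $\|f\|^2=\sum_\alpha\|f_\alpha\|^2/\rho_m(\alpha)<\infty$, where $\rho_m(\alpha)=\frac{(m+|\alpha|-1)!}{\alpha!(m-1)!}$. $M_z=(M_{z_1},\ldots,M_{z_n})$ is the tuple of multiplications by the coordinate functions. Two tuples are unitarily equivalent if a single unitary operator intertwines them componentwise. *)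

(* Defs.v *)
From HB Require Import structures.
From mathcomp Require Import all_boot all_order all_algebra.
From mathcomp Require Import sesquilinear complex finmap.
From mathcomp Require Import all_classical all_reals all_analysis.

Set Implicit Arguments.
Unset Strict Implicit.
Unset Printing Implicit Defensive.

Import Order.TTheory GRing.Theory Num.Theory.
Import numFieldNormedType.Exports.

Local Open Scope classical_set_scope.
Local Open Scope ring_scope.

(* As in sesquilinear.v, the form is linear in its first argument. *)
HB.mixin Record NormedModule_isHilbert (C : numClosedFieldType) V
    & CompleteNormedModule C V := {
  hdot : {dot V for (@Num.conj C)} ;
  hdot_norm : forall x : V, hdot x x = `|x| ^+ 2
}.

#[short(type="hilbertType")]
HB.structure Definition Hilbert (C : numClosedFieldType) :=
  {V of CompleteNormedModule C V & NormedModule_isHilbert C V}.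

Record bounded_operator (C : numClosedFieldType) (H : hilbertType C) :=
  BoundedOperator {
    bounded_operator_linear :> {linear H -> H} ;
    bounded_operator_continuous : continuous bounded_operator_linear
  }.

Section Operators.
Variables (C : numClosedFieldType) (n : nat).
Implicit Types H : hilbertType C.

(* The Riesz representation theorem yields exactly one such w. *)
Definition adjoint H (A : bounded_operator H) (y : H) : H :=
  xget 0 [set w | forall x, hdot (A x) y = hdot x w].

Definition commuting H (T : 'I_n -> bounded_operator H) :=
  forall i j x, T i (T j x) = T j (T i x).

(* Elements of H^n are finite functions. Only the Hilbert norm of H^n is used
   below, so {ffun 'I_n -> H} is not given a topology. *)
Definition row_norm H (h : {ffun 'I_n -> H}) : C :=
  sqrtC (\sum_i `|h i| ^+ 2).

Definition row_op H (T : 'I_n -> bounded_operator H) (h : {ffun 'I_n -> H}) : H :=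
  \sum_i T i (h i).

Definition row_adj H (T : 'I_n -> bounded_operator H) (x : H) : {ffun 'I_n -> H} :=
  [ffun i => adjoint (T i) x].

Definition row_contraction H (T : 'I_n -> bounded_operator H) :=
  forall h, `|row_op T h| <= row_norm h.

Definition wandering H (T : 'I_n -> bounded_operator H) : set H :=
  [set w | forall v, range (row_op T) v -> hdot w v = 0].

Definition euclid_norm (z : 'rV[C]_n) : C := sqrtC (\sum_i `|z 0 i| ^+ 2).

Definition row_scalar H (z : 'rV[C]_n) (h : {ffun 'I_n -> H}) : H :=
  \sum_i z 0 i *: h i.

Definition algebraic_direct_sum H (A B : set H) :=
  (forall x, exists a b, [/\ A a, B b & x = a + b]) /\ A `&` B = [set 0].

Definition regular_at0 H (T : 'I_n -> bounded_operator H) :=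
  closed (range (row_op T)) /\
  exists2 eps : C, 0 < eps &
    forall z : 'rV[C]_n, euclid_norm z < eps ->
      let ran := range (fun h => row_op T h - row_scalar z h) in
      closed ran /\ algebraic_direct_sum ran (wandering T).

Definition sigma H (T : 'I_n -> bounded_operator H) (X : H -> H) (x : H) : H :=
  \sum_i T i (X (adjoint (T i) x)).

(* The inverse of T^*T : Im T^* -> Im T^*, which is a bijection when the range
   of the row operator is closed; 0 is a junk value off the image. *)
Definition inv_TstarT H (T : 'I_n -> bounded_operator H) :
    {ffun 'I_n -> H} -> {ffun 'I_n -> H} :=
  'pinv_(fun=> 0) (range (row_adj T)) (row_adj T \o row_op T).

Definition operator_identity H (m : nat) (T : 'I_n -> bounded_operator H) :=
  forall v, range (row_adj T) v ->
    inv_TstarT T v =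
    [ffun i => \sum_(j < m)
       ((-1) ^+ j * 'C(m, j.+1)%:R) *: iter j (sigma T) idfun (v i)].

Definition spherical_coisometry H (S : 'I_n -> bounded_operator H) :=
  commuting S /\ forall x, \sum_i S i (adjoint (S i) x) = x.

(* H is the orthogonal direct sum of H0 and H1, which are embedded in H by the
   isometries J0 and J1. *)
Definition orthogonal_direct_sum H H0 H1
    (J0 : {linear H0 -> H}) (J1 : {linear H1 -> H}) :=
  [/\ forall x y, hdot (J0 x) (J0 y) = hdot x y,
      forall x y, hdot (J1 x) (J1 y) = hdot x y,
      forall x y, hdot (J0 x) (J1 y) = 0
    & forall h, exists x y, h = J0 x + J1 y].

Definition tuple_direct_sum H H0 H1 (T : 'I_n -> bounded_operator H)
    (T0 : 'I_n -> bounded_operator H0) (T1 : 'I_n -> bounded_operator H1) :=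
  exists (J0 : {linear H0 -> H}) (J1 : {linear H1 -> H}),
    orthogonal_direct_sum J0 J1 /\
    forall i x y, T i (J0 x + J1 y) = J0 (T0 i x) + J1 (T1 i y).

End Operators.

Section FunctionalHilbertSpace.
Variables (R : realType) (n : nat) (D : hilbertType R[i]).

Definition multiindex := {ffun 'I_n -> nat}.

Definition unit_ball := {z : 'rV[R[i]]_n | euclid_norm z < 1}.

Definition monomial (z : 'rV[R[i]]_n) (a : multiindex) : R[i] :=
  \prod_i z 0 i ^+ a i.

Definition rho (m : nat) (a : multiindex) : R :=
  ((m + \sum_i a i).-1)`!%:R / ((\prod_i (a i)`!) * (m.-1)`!)%:R.

(* Unordered convergence of the series, along the finite sets of indices. *)
Definition power_series (f : unit_ball -> D) (c : multiindex -> D) :=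
  forall (z : unit_ball) (eps : R[i]), 0 < eps ->
    exists A : {fset multiindex}, forall B : {fset multiindex},
      (A `<=` B)%fset ->
      `|f z - \sum_(a <- B) monomial (sval z) a *: c a| < eps.

(* The coefficients are unique, by the identity theorem for power series. *)
Definition taylor_coef (f : unit_ball -> D) : multiindex -> D :=
  xget (fun=> 0) [set c | power_series f c].

Definition Hm_sqnorm (m : nat) (f : unit_ball -> D) : \bar R :=
  (\esum_(a in [set: multiindex])
     (complex.Re `|taylor_coef f a| ^+ 2 / rho m a)%:E)%E.

Definition Hm (m : nat) : set (unit_ball -> D) :=
  [set f | (exists c, power_series f c) /\ (Hm_sqnorm m f < +oo)%E].

Definition mult_coord (i : 'I_n) (f : unit_ball -> D) : unit_ball -> D :=
  fun z => sval z 0 i *: f z.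

(* U is a unitary operator (a surjective linear isometry) from H1 onto the
   function space Hm. *)
Definition unitarily_equivalent_Mz (m : nat) (H1 : hilbertType R[i])
    (S : 'I_n -> bounded_operator H1) :=
  exists U : {linear H1 -> (unit_ball -> D)},
    [/\ range U = Hm m,
        forall x, Hm_sqnorm m (U x) = (complex.Re `|x| ^+ 2)%:E
      & forall i x, U (S i x) = mult_coord i (U x)].

End FunctionalHilbertSpace.

(* Main.v *)
(* With [delta = sum_j (-1)^j C(m,j+1) sigma_T^j(1)], the operator identity says
   that [1 - sigma_T(delta) = (1 - sigma_T)^m(1)], called [defect T m] below, is
   the orthogonal projection onto [W(T)].  Put [G(z) = sum_i z_i delta T_i^*].  For
   small [z] every [x] is [(1 - G(z)) y], which differs from the wandering part of
   [y] by an element of [(T - Z)H^n]; so regularity makes the wandering part of [y]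
   vanish whenever [x] is in [(T - Z)H^n].  Comparing coefficients of [z], the
   vectors [E_k = (G(z)^* )^k w] with [w] wandering satisfy
   [T_i^* E_(k+1) = conj(z_i) E_k] and [T_i^* E_0 = 0].  Hence
   [(1 - sigma_T)^m(1)] acts on the formal series [sum_k E_k] as [(1 - A)^m], where
   [A = sum_i conj(z_i) T_i], and maps it to [w]; so [E_k = C(m+k-1,k) A^k w].
   Expanding [A^k] gives [rho(a) T_i^* T^a w = rho(a - e_i) T^(a - e_i) w], which is
   the relation defining [M_z] on [H_m]: the closed span of the [T^a w] is reducing
   and unitarily equivalent to [M_z].  On its complement [(1 - sigma_T)^m(1) = 0],
   which forces [sigma_T(1) = 1] because [T] is a row contraction.

   Conversely, on [H_m] every [sigma_T^j(1)] is diagonal in the monomials with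
   weights depending only on the degree, and the identity is checked there. *)
Require Import Defs.
From HB Require Import structures.
From mathcomp Require Import all_boot all_order all_algebra.
From mathcomp Require Import sesquilinear complex finmap ring lra.
From mathcomp Require Import all_classical all_reals all_analysis.
From mathcomp Require summability.
Set Implicit Arguments.
Unset Strict Implicit.
Unset Printing Implicit Defensive.
Import Order.TTheory GRing.Theory Num.Theory.
Import numFieldNormedType.Exports.
Local Open Scope classical_set_scope.
Local Open Scope ring_scope.
Local Notation Re := complex.Re.
Local Notation Im := complex.Im.

(** * Real-valued norm of a complex Hilbert space *)

Section RealNorm.
Variable R : realType.
Local Notation C := R[i].
Implicit Types H : hilbertType C.

(** The weights of [delta] are the coefficients of [(1 - (1 - x)^m) / x], so that
    [1 - x delta(x) = (1 - x)^m]. The forward direction uses the operator identity only as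
    [T_i^* sigma(delta) = T_i^*], that is [T_i^* P = 0] for [P = defect T m]; as [P] is self-adjoint
    and fixes [W(T)], it is the projection. Powers of [1 - A] appear because the relation between
    [E_(k+1)] and [E_k] gives [sigma(X) E_(k+1) = A X E_k] for linear [X], so one application of
    [1 - sigma] costs one factor [1 - A]. No analytic function of [z] is needed there: [z = t s]
    with [s] fixed and [t] real and small, and powers of [t] are compared in a finite expansion with
    remainder [O(t^N)]. Separating the monomials in [z] is then a question about polynomials. In the
    converse the obstacle is that [U] is only known to preserve norms, so the adjoint of the shift
    has to be recovered by polarization against single monomials. Moreover [delta] must be shown to
    map [Im T^*] into itself before the inverse of [T^*T] can be computed. *)

Lemma Re_conj (a : C) : Re a^* = Re a.
Proof. by case: a. Qed.

Lemma ReD (a b : C) : Re (a + b) = Re a + Re b.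
Proof. by case: a => ? ?; case: b. Qed.

Lemma ReN (a : C) : Re (- a) = - Re a.
Proof. by case: a. Qed.

Lemma Re_realM (r : R) (a : C) : Re (r%:C%C * a) = r * Re a.
Proof. by case: a => a b /=; rewrite mul0r subr0. Qed.

Lemma Re_le_norm (a : C) : Re a <= Re `|a|.
Proof.
rewrite normc_def /= (le_trans (ler_norm _))// -sqrtr_sqr ler_wsqrtr//.
by rewrite lerDl sqr_ge0.
Qed.

Lemma Re_ge0 (a : C) : 0 <= a -> 0 <= Re a.
Proof. by rewrite lecE => /andP[_]. Qed.

Lemma Re_norm_ge0 (V : normedZmodType C) (x : V) : 0 <= Re `|x|.
Proof. exact: Re_ge0. Qed.

(** The norm takes values in [R[i]], whose order is partial; its real part lives in [R], where [lra]
    and [nra] apply. *)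
Definition rnorm (V : normedZmodType C) (x : V) : R := Re `|x|.

Section Norm.
Variable V : normedModType C.
Implicit Types x y : V.

Lemma rnormE x : `|x| = (rnorm x)%:C%C.
Proof. by rewrite RRe_real// normr_real. Qed.

Lemma rnorm_ge0 x : 0 <= rnorm x.
Proof. exact: Re_norm_ge0. Qed.

Lemma rnormD x y : rnorm (x + y) <= rnorm x + rnorm y.
Proof. by rewrite -lecR rmorphD /= -!rnormE ler_normD. Qed.

Lemma rnormN x : rnorm (- x) = rnorm x.
Proof. by rewrite /rnorm normrN. Qed.

Lemma rnorm_distC x y : rnorm (x - y) = rnorm (y - x).
Proof. by rewrite /rnorm distrC. Qed.

Lemma rnormZ (a : C) x : rnorm (a *: x) = Re `|a| * rnorm x.
Proof.
by rewrite /rnorm normrZ -[X in X * _](RRe_real (normr_real a)) Re_realM.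
Qed.

Lemma rnormZr (r : R) x : 0 <= r -> rnorm (r%:C%C *: x) = r * rnorm x.
Proof. by move=> r0; rewrite rnormZ ger0_norm// ler0c. Qed.

Lemma rnorm0 : rnorm (0 : V) = 0.
Proof. by rewrite /rnorm normr0. Qed.

Lemma rnorm_eq0 x : (rnorm x == 0) = (x == 0).
Proof. by rewrite -(normr_eq0 x) rnormE fmorph_eq0. Qed.

Lemma rnorm_eps x : (forall e, 0 < e -> rnorm x <= e) -> x = 0.
Proof.
move=> xe; apply/eqP; rewrite -rnorm_eq0 eq_le rnorm_ge0 andbT.
by apply/ler_addgt0Pl => e e0; rewrite addr0 xe.
Qed.

Lemma rnormB_tri z x y : rnorm (x - y) <= rnorm (x - z) + rnorm (y - z).
Proof.
have -> : x - y = (x - z) + (z - y) by rewrite addrA subrK.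
by rewrite (rnorm_distC y) rnormD.
Qed.

Lemma rnorm_sum (I : Type) (r : seq I) (P : pred I) (F : I -> V) :
  rnorm (\sum_(i <- r | P i) F i) <= \sum_(i <- r | P i) rnorm (F i).
Proof.
elim/big_rec2: _ => [|i y x _ yx]; first by rewrite rnorm0.
by rewrite (le_trans (rnormD _ _))// lerD2l.
Qed.

Lemma ballE x y (e : C) : ball x e y <-> `|x - y| < e.
Proof. by rewrite -ball_normE. Qed.

End Norm.

Section Complete.
Variable V : completeNormedModType C.

(** A general filter covers the three later uses: sequences, finite index sets ordered by inclusion,
    and Cauchy filters on a subspace. *)
Lemma rnorm_cauchy_cvg (I : Type) (F : set_system I) (FF : ProperFilter F)
    (u : I -> V) :
  (forall e : R, 0 < e -> exists2 A, F A &
     forall s t, A s -> A t -> rnorm (u s - u t) <= e) ->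
  exists l, forall e : R, 0 < e -> F [set s | rnorm (u s - l) <= e].
Proof.
move=> cau; have cF : cauchy (u @ F).
  move=> E; rewrite -entourage_ballE => -[e /= e0 eE].
  have := e0; rewrite ltcE => /andP[/eqP /= ie0 re0].
  have eE' : e = (Re e)%:C%C by rewrite -[LHS]RRe_real// gtr0_real.
  have [//|A FA Ae] := cau (Re e / 2); first by rewrite divr_gt0.
  exists (u @` A, u @` A) => /=.
    have FuA : F (u @^-1` (u @` A)) by apply: filterS FA => s As; exists s.
    by split.
  move=> [a b] /= [[s As <-] [t At <-]]; apply: eE => /=.
  apply/ballE; rewrite rnormE eE' ltcR (le_lt_trans (Ae _ _ As At))//; lra.
have cl : cvg (u @ F) by exact: cauchy_cvg.
exists (lim (u @ F)) => e e0.
move/cvgrPdist_le : cl => /(_ e%:C%C).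
rewrite ltcR => /(_ e0); apply: filterS => s.
by rewrite rnormE lecR rnorm_distC.
Qed.

End Complete.
End RealNorm.

(** * Inner products, Cauchy-Schwarz and Riesz representation *)

Section HilbertBasics.
Variable R : realType.
Local Notation C := R[i].
Variable H : hilbertType C.
Implicit Types x y z : H.

Lemma hdotDl x y z : hdot (x + y) z = hdot x z + hdot y z.
Proof. exact: linearDl. Qed.

Lemma hdotDr x y z : hdot z (x + y) = hdot z x + hdot z y.
Proof. exact: linearDr. Qed.

Lemma hdotBl x y z : hdot (x - y) z = hdot x z - hdot y z.
Proof. exact: linearBl. Qed.

Lemma hdotBr x y z : hdot z (x - y) = hdot z x - hdot z y.
Proof. exact: linearBr. Qed.

Lemma hdotZl (a : C) x y : hdot (a *: x) y = a * hdot x y.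
Proof. exact: linearZl_LR. Qed.

Lemma hdotZr (a : C) x y : hdot x (a *: y) = a^* * hdot x y.
Proof. exact: linearZr_LR. Qed.

Lemma hdot0l x : hdot 0 x = 0.
Proof. exact: linear0l. Qed.

Lemma hdot0r x : hdot x 0 = 0.
Proof. exact: linear0r. Qed.

Lemma hdotC x y : hdot x y = (hdot y x)^*.
Proof. by rewrite hermC /= expr0 mul1r. Qed.

Lemma hdot_suml (I : Type) (r : seq I) (P : pred I) (F : I -> H) y :
  hdot (\sum_(i <- r | P i) F i) y = \sum_(i <- r | P i) hdot (F i) y.
Proof. exact: linear_sumlz. Qed.

Lemma hdot_sumr (I : Type) (r : seq I) (P : pred I) (F : I -> H) y :
  hdot y (\sum_(i <- r | P i) F i) = \sum_(i <- r | P i) hdot y (F i).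
Proof. exact: linear_sumr. Qed.

Lemma hdot_eq0C x y : hdot x y = 0 -> hdot y x = 0.
Proof. by move=> e; rewrite hdotC e rmorph0. Qed.

Lemma hdotxx x : hdot x x = (rnorm x ^+ 2)%:C%C.
Proof. by rewrite hdot_norm rnormE rmorphXn. Qed.

Lemma rnorm_sq x : rnorm x ^+ 2 = Re (hdot x x).
Proof. by rewrite hdotxx. Qed.

Lemma hdotxx_eq0 x : hdot x x = 0 -> x = 0.
Proof.
by move/(congr1 (@complex.Re R)); rewrite -rnorm_sq => /eqP; rewrite sqrf_eq0 rnorm_eq0 => /eqP.
Qed.

Lemma hdot_ext x y : (forall z, hdot x z = hdot y z) -> x = y.
Proof.
by move=> e; apply/eqP; rewrite -subr_eq0; apply/eqP/hdotxx_eq0; rewrite hdotBl e subrr.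
Qed.

Lemma rnormD_sq x y :
  rnorm (x + y) ^+ 2 = rnorm x ^+ 2 + rnorm y ^+ 2 + 2 * Re (hdot x y).
Proof.
rewrite !rnorm_sq hdotDl !hdotDr !ReD (hdotC y x) Re_conj; ring.
Qed.

Lemma rnormB_sq x y :
  rnorm (x - y) ^+ 2 = rnorm x ^+ 2 + rnorm y ^+ 2 - 2 * Re (hdot x y).
Proof.
rewrite !rnorm_sq hdotBl !hdotBr !(ReD, ReN) (hdotC y x) Re_conj; ring.
Qed.

Lemma hdot_rot x y : exists2 a : C, `|a| = 1 & Re (hdot (a *: x) y) = Re `|hdot x y|.
Proof.
have [e|ne] := eqVneq (hdot x y) 0.
  by exists 1; rewrite ?normr1// scale1r e normr0.
exists (`|hdot x y| / hdot x y); first by rewrite normf_div normr_id divff ?normr_eq0.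
by rewrite hdotZl divfK.
Qed.

Lemma cauchy_schwarz_re x y : Re (hdot x y) <= rnorm x * rnorm y.
Proof.
have [->|y0] := eqVneq y 0; first by rewrite hdot0r rnorm0 mulr0.
have [->|x0] := eqVneq x 0; first by rewrite hdot0l rnorm0 mul0r.
have px : 0 < rnorm x by rewrite lt_def rnorm_eq0 x0 rnorm_ge0.
have py : 0 < rnorm y by rewrite lt_def rnorm_eq0 y0 rnorm_ge0.
(* The squared norm of this vector is [2 |x| |y| (|x| |y| - Re <x, y>)]. *)
have := sqr_ge0 (rnorm ((rnorm y)%:C%C *: x - (rnorm x)%:C%C *: y)).
rewrite rnormB_sq !rnormZr ?rnorm_ge0// hdotZl hdotZr.
have -> : ((rnorm x)%:C%C)^* = (rnorm x)%:C%C :> C by exact: conjc_real.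
rewrite !Re_realM => h.
rewrite -(ler_pM2l (mulr_gt0 px py)); nra.
Qed.

Lemma cauchy_schwarz x y : Re `|hdot x y| <= rnorm x * rnorm y.
Proof.
have [a a1 <-] := hdot_rot x y.
by rewrite (le_trans (cauchy_schwarz_re _ _))// rnormZ a1 mul1r.
Qed.

Lemma hdot_eps (a : C) : (forall e, 0 < e -> Re `|a| <= e) -> a = 0.
Proof.
move=> h; apply/eqP; rewrite -normr_eq0 -(RRe_real (normr_real a)) fmorph_eq0.
rewrite eq_le Re_norm_ge0 andbT.
by apply/ler_addgt0Pl => e e0; rewrite addr0 h.
Qed.

(* Riesz: a minimizing sequence of x |-> |x|^2 - 2 Re (f x) is Cauchy by the
   parallelogram law, and its limit represents f. *)
Lemma riesz (f : H -> C) (M : R) :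
  (forall a x y, f (a *: x + y) = a * f x + f y) ->
  (forall x, Re `|f x| <= M * rnorm x) ->
  exists w, forall x, f x = hdot x w.
Proof.
move=> fl fM.
have f0 : f 0 = 0.
  have /eqP := fl 1 0 0; rewrite scale1r addr0 mul1r.
  by rewrite -subr_eq0 opprD addrA subrr add0r oppr_eq0 => /eqP.
have fZ a x : f (a *: x) = a * f x by rewrite -[a *: x]addr0 fl f0 addr0.
have fD x y : f (x + y) = f x + f y by rewrite -[x]scale1r fl mul1r scale1r.
have fB x y : f (x - y) = f x - f y by rewrite fD -scaleN1r fZ mulN1r.
pose J x := rnorm x ^+ 2 - 2 * Re (f x).
have Jlb x : - M ^+ 2 <= J x.
  have h1 := le_trans (Re_le_norm (f x)) (fM x).
  have := sqr_ge0 (rnorm x - M); rewrite /J; nra.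
have hasJ : has_inf (range J).
  by split; [exists (J 0), 0|exists (- M ^+ 2) => _ [x _ <-]].
pose I := inf (range J).
have IJ x : I <= J x by apply: ge_inf; [case: hasJ|exists x].
have Jpar x y : rnorm (x - y) ^+ 2 <= 2 * (J x - I) + 2 * (J y - I).
  have := IJ ((2^-1)%:C%C *: (x + y)).
  rewrite rnormB_sq {1}/J rnormZr ?invr_ge0// fZ Re_realM fD ReD exprMn rnormD_sq.
  have -> : (2^-1 : R) = 1 / 2 by rewrite mul1r.
  rewrite /J; lra.
have ex k : exists x, J x <= I + k.+1%:R^-1.
  have k0 : 0 < (k.+1%:R^-1 : R) by rewrite invr_gt0.
  have [_ [x _ <-] xI] := inf_adherent k0 hasJ.
  by exists x; exact: ltW.
have [u uP] := choice ex.
have [|l lP] := @rnorm_cauchy_cvg _ _ _ (\oo : set_system nat) _ u.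
  move=> e e0; have e4 : 0 < e ^+ 2 / 4 by rewrite divr_gt0 ?exprn_gt0.
  have hn : \forall k \near \oo, k.+1%:R^-1 <= (e ^+ 2 / 4 : R).
    by have := @near_infty_natSinv_lt R (PosNum e4); apply: filterS => k /ltW.
  exists [set k | k.+1%:R^-1 <= (e ^+ 2 / 4 : R)] => // s t hs ht.
  rewrite -(@ler_pXn2r _ 2)// ?nnegrE ?rnorm_ge0 ?(ltW e0)//.
  rewrite (le_trans (Jpar _ _))//; 
  have {}hs : s.+1%:R^-1 <= (e ^+ 2 / 4 : R) := hs.
  have {}ht : t.+1%:R^-1 <= (e ^+ 2 / 4 : R) := ht.
  have := uP s; have := uP t; have := rnorm_ge0 (u s - u t).
  move: (J (u s)) (J (u t)) (s.+1%:R^-1) (t.+1%:R^-1) hs ht => a b c d; lra.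
(* An explicit semicontinuity estimate, by which the limit [l] attains the infimum. *)
have J_lip x : J l <= J x + rnorm (x - l) * (2 * rnorm l + 3 * rnorm (x - l) + 2 * `|M|).
  have lx : rnorm l <= rnorm x + rnorm (x - l).
    by rewrite -{1}[l](subrK x) addrC (le_trans (rnormD _ _))// lerD2l rnorm_distC.
  have xl : rnorm x <= rnorm l + rnorm (x - l).
    by rewrite -{1}[x](subrK l) addrC (le_trans (rnormD _ _)).
  have fxl : Re (f x) - Re (f l) <= `|M| * rnorm (x - l).
    rewrite -ReN -ReD -fB (le_trans (Re_le_norm _))// (le_trans (fM _))//.
    by rewrite ler_wpM2r ?rnorm_ge0// ler_norm.
  have := rnorm_ge0 l; have := rnorm_ge0 x; have := rnorm_ge0 (x - l).
  rewrite /J; nra.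
have Jl : J l <= I.
  apply/ler_addgt0Pl => e e0; pose K := 2 * rnorm l + 3 + 2 * `|M|.
  have K0 : 0 < K.
    by have := rnorm_ge0 l; have := normr_ge0 M; rewrite /K; lra.
  have e2 : 0 < e / 2 by rewrite divr_gt0.
  have d0 : 0 < Order.min 1 (e / 2 / K) by rewrite lt_min ltr01 divr_gt0.
  have F1 := lP _ d0.
  have F2 : \forall k \near \oo, k.+1%:R^-1 <= (e / 2 : R).
    by have := @near_infty_natSinv_lt R (PosNum e2); apply: filterS => k /ltW.
  have [k [/= k1 k2]] := filter_ex (filterI F1 F2).
  move: k1; rewrite le_min => /andP[k1 k3].
  have := uP k; have := J_lip (u k); have := rnorm_ge0 (u k - l).
  have : rnorm (u k - l) * K <= e / 2 by rewrite -ler_pdivlMr.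
  rewrite /K; move: k1 k2 (rnorm_ge0 l) (normr_ge0 M).
  move: (rnorm (u k - l)) (rnorm l) `|M| (J l) (J (u k)) (k.+1%:R^-1) => d L M' Jl Ju kk.
  move=> d1 h1 h2 h3 h4 h5 h6 h7.
  have dd : d * d <= d by rewrite ler_piMr.
  lra.
exists l.
have ReE h : Re (f h) = Re (hdot h l).
  pose g := Re (hdot h l) - Re (f h).
  have q t : 0 <= t ^+ 2 * rnorm h ^+ 2 + 2 * t * g.
    have := le_trans Jl (IJ (l + t%:C%C *: h)).
    rewrite /J rnormD_sq (hdotC l) Re_conj hdotZl fD fZ ReD !Re_realM rnormZ exprMn.
    have -> : Re `|t%:C%C| ^+ 2 = t ^+ 2 :> R.
      by rewrite normc_def /= expr0n addr0 sqrtr_sqr real_normK ?num_real.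
    rewrite /g; lra.
  have [/eqP|g0] := eqVneq g 0; first by rewrite subr_eq0 => /eqP.
  (* Minimality at [l] makes [t^2 |h|^2 + 2 t g] nonnegative for all real [t]. The choice
     [t = - g / s] contradicts this unless [g = 0]; the added 1 keeps [s] positive even for
     [h = 0]. *)
  have s0 := sqr_ge0 (rnorm h); pose s := rnorm h ^+ 2 + 1.
  have s1 : 0 < s by rewrite /s; lra.
  have := q (- g / s); have -> : rnorm h ^+ 2 = s - 1 by rewrite /s; ring.
  have -> : (- g / s) ^+ 2 * (s - 1) + 2 * (- g / s) * g = - (g / s) ^+ 2 * (s + 1).
    by field; rewrite gt_eqF.
  rewrite mulNr oppr_ge0 pmulr_lle0; last by lra.
  by rewrite le_eqVlt ltNge sqr_ge0 orbF sqrf_eq0 mulf_eq0 invr_eq0 (negPf g0) gt_eqF.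
move=> x; apply/eqP; rewrite -subr_eq0; apply/eqP.
(* Equality of real parts at [d^* *: x] reads [|d|^2 = 0]. *)
set d := f x - hdot x l.
have : Re (f (d^* *: x) - hdot (d^* *: x) l) = 0 by rewrite ReD ReN ReE subrr.
rewrite fZ hdotZl -mulrBr -/d mulrC -normCK.
rewrite -(RRe_real (normr_real d)) -rmorphXn.
move=> /= /eqP; rewrite sqrf_eq0 => /eqP d0; apply: hdot_eps => e e0.
by rewrite -[Re _]/(Normc.normc d) d0 ltW.
Qed.

End HilbertBasics.

(** * Adjoints of bounded operators *)

Section Adjoint.
Variable R : realType.
Local Notation C := R[i].
Variable H : hilbertType C.
Implicit Types (x y : H) (A : bounded_operator H).

Lemma bounded_operator_bound A :
  exists2 M : R, 0 <= M & forall x, rnorm (A x) <= M * rnorm x.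
Proof.
have /linear_bounded_continuous/linear_boundedP hA := @bounded_operator_continuous _ _ A.
have [M [M0 hM]] := pinfty_ex_gt0 hA.
exists (Re M) => [|x]; first by apply/Re_ge0/ltW.
have := hM x; rewrite !rnormE.
have EM : M = (Re M)%:C%C by rewrite RRe_real ?gtr0_real.
by rewrite {1}EM -rmorphM lecR.
Qed.

(** The Riesz theorem makes the set in the definition of [adjoint] nonempty, so [xget] does not
    return its default 0. *)
Lemma adjointP A x y : hdot (A x) y = hdot x (adjoint A y).
Proof.
have [M M0 hM] := bounded_operator_bound A.
have [a u v|v|w wP] := @riesz _ _ (fun v => hdot (A v) y) (M * rnorm y).
- by rewrite linearP hdotDl hdotZl.
- by rewrite (le_trans (cauchy_schwarz _ _))// mulrAC ler_wpM2r ?rnorm_ge0.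
have : [set w | forall v, hdot (A v) y = hdot v w] (adjoint A y).
  exact: xgetPex (ex_intro _ w wP).
exact.
Qed.

Lemma adjointPr A x y : hdot x (A y) = hdot (adjoint A x) y.
Proof. by rewrite hdotC adjointP -hdotC. Qed.

Lemma adjoint_eq A y w : (forall x, hdot (A x) y = hdot x w) -> adjoint A y = w.
Proof.
by move=> h; apply: hdot_ext => z; rewrite hdotC -adjointP h -hdotC.
Qed.

Lemma adjoint_is_linear A : linear (adjoint A).
Proof.
move=> a x y; apply: adjoint_eq => z.
by rewrite !hdotDr !hdotZr !adjointP.
Qed.
HB.instance Definition _ A :=
  GRing.isLinear.Build _ _ _ _ (adjoint A) (adjoint_is_linear A).

End Adjoint.

Section BoundedOperators.
Variable R : realType.
Local Notation C := R[i].
Variable H : hilbertType C.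

Lemma rnorm_continuous (V W : normedModType C) (f : {linear V -> W}) (M : R) :
  (forall x, rnorm (f x) <= M * rnorm x) -> continuous f.
Proof.
move=> hM; apply: bounded_linear_continuous; apply/linear_boundedP.
near=> r => x; rewrite !rnormE.
have : M%:C%C <= r by near: r; apply: nbhs_pinfty_ge; rewrite complex_real.
move=> Mr; apply: (@le_trans _ _ ((M * rnorm x)%:C%C)); first by rewrite lecR.
by rewrite rmorphM ler_wpM2r// ler0c rnorm_ge0.
Unshelve. all: by end_near. Qed.

Definition mk_bounded (f : {linear H -> H}) (M : R)
    (hM : forall x, rnorm (f x) <= M * rnorm x) : bounded_operator H :=
  BoundedOperator (rnorm_continuous hM).

End BoundedOperators.

(** * Orthogonal complements as Hilbert spaces *)

Section Orthocomplement.
Variable R : realType.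
Local Notation C := R[i].
Variable H : hilbertType C.
Variable S : set H.

(** All subspaces that occur, [W(T)] and the two summands, are orthogonal complements of sets;
    completeness is then proved once, for an arbitrary set [S]. *)
Definition ortho_pred : {pred H} := fun x => `[< forall s, S s -> hdot x s = 0 >].

Lemma ortho_predP x : reflect (forall s, S s -> hdot x s = 0) (x \in ortho_pred).
Proof. exact: asboolP. Qed.

Lemma ortho_submod : submod_closed ortho_pred.
Proof.
split=> [|a x y /ortho_predP hx /ortho_predP hy]; apply/ortho_predP => s Ss.
  by rewrite hdot0l.
by rewrite hdotDl hdotZl hx// hy// mulr0 addr0.
Qed.
HB.instance Definition _ := GRing.isSubmodClosed.Build C H ortho_pred ortho_submod.

Record ortho := Ortho { ortho_val : H; orthoP : ortho_val \in ortho_pred }.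

HB.instance Definition _ := [isSub for ortho_val].
HB.instance Definition _ := [Choice of ortho by <:].
HB.instance Definition _ := [SubChoice_isSubLmodule of ortho by <:].

Definition ortho_norm (x : ortho) : C := `|val x|.

Lemma ortho_normD x y : ortho_norm (x + y) <= ortho_norm x + ortho_norm y.
Proof. by rewrite /ortho_norm raddfD ler_normD. Qed.

Lemma ortho_normZ (a : C) x : ortho_norm (a *: x) = `|a| * ortho_norm x.
Proof. by rewrite /ortho_norm linearZ normrZ. Qed.

Lemma ortho_norm0_eq0 x : ortho_norm x = 0 -> x = 0.
Proof. by move=> /normr0_eq0 x0; apply: val_inj; rewrite /= x0. Qed.

HB.instance Definition _ := @Lmodule_isNormed.Build C ortho ortho_norm
  ortho_normD ortho_normZ ortho_norm0_eq0.

Lemma ortho_rnorm (x : ortho) : rnorm x = rnorm (val x).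
Proof. by []. Qed.

Lemma ortho_complete (F : set_system ortho) : ProperFilter F -> cauchy F -> cvg F.
Proof.
move=> FF cF.
have [e e0|l lP] := @rnorm_cauchy_cvg _ _ _ F FF (val : ortho -> H).
  have e0' : 0 < e%:C%C :> C by rewrite ltcR.
  have [[A B] /= [FA FB] AB] := cF _ (entourage_ball (ortho : pseudoMetricType C) (PosNum e0')).
  exists (A `&` B); first exact: filterI.
  move=> s t [As Bs] [At Bt]; have st : ball s e%:C%C t := AB (s, t) (conj As Bt).
  by move/ballE : st; rewrite rnormE ltcR => /ltW; rewrite ortho_rnorm raddfB.
have lS : l \in ortho_pred.
  apply/ortho_predP => s Ss; apply: hdot_eps => e e0.
  have d0 : 0 < e / (rnorm s + 1) by rewrite divr_gt0// ltr_wpDl ?rnorm_ge0.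
  have [x xl] := filter_ex (lP _ d0).
  have -> : hdot l s = - hdot (val x - l) s.
    by rewrite hdotBl (ortho_predP _ (orthoP x))// sub0r opprK.
  rewrite normrN (le_trans (cauchy_schwarz _ _))//.
  rewrite (le_trans (ler_wpM2r (rnorm_ge0 s) xl))// mulrAC ler_pdivrMr ?ltr_wpDl ?rnorm_ge0//.
  by rewrite ler_pM2l// lerDl.
apply/cvg_ex; exists (Ortho lS); apply/cvgrPdist_le => e e0.
have := lP (Re e); have := e0; rewrite ltcE => /andP[_ /= re0] /(_ re0).
apply: filterS => x; rewrite rnormE (_ : e = (Re e)%:C%C); last by rewrite RRe_real// gtr0_real.
by rewrite lecR ortho_rnorm raddfB rnorm_distC.
Qed.
HB.instance Definition _ := Uniform_isComplete.Build ortho ortho_complete.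

Definition ortho_dot (x y : ortho) : C := hdot (val x) (val y).

Lemma ortho_dot_linear_l y : linear_for *%R (ortho_dot ^~ y).
Proof. by move=> a u v; rewrite /ortho_dot linearP hdotDl hdotZl. Qed.

Lemma ortho_dot_linear_r x : linear_for (@Num.conj C \; *%R) (ortho_dot x).
Proof. by move=> a u v; rewrite /ortho_dot [val (_ + _)]linearP hdotDr hdotZr. Qed.

HB.instance Definition _ := @bilinear_isBilinear.Build C ortho ortho C
  *%R (@Num.conj C \; *%R) ortho_dot (ortho_dot_linear_l, ortho_dot_linear_r).

Lemma ortho_dot_hermitian x y : ortho_dot x y = (-1) ^+ false * (ortho_dot y x)^*.
Proof. by rewrite expr0 mul1r [LHS]hdotC. Qed.
HB.instance Definition _ := isHermitianSesquilinear.Build C ortho false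
  (@Num.conj C) ortho_dot ortho_dot_hermitian.

Lemma ortho_dot_gt0 x : x != 0 -> 0 < ortho_dot x x.
Proof.
by move=> x0; rewrite /ortho_dot hdotxx ltcR exprn_gt0// lt_def rnorm_ge0 rnorm_eq0 andbT.
Qed.
HB.instance Definition _ := isDotProduct.Build C ortho ortho_dot ortho_dot_gt0.

Lemma ortho_dot_norm x : ortho_dot x x = `|x| ^+ 2.
Proof. by rewrite /ortho_dot hdot_norm. Qed.
HB.instance Definition _ := NormedModule_isHilbert.Build C ortho ortho_dot_norm.

Lemma ortho_hdot (x y : ortho) : hdot x y = hdot (val x) (val y).
Proof. by []. Qed.

End Orthocomplement.

(** * Unordered sums and polynomial coefficients *)

Section UnorderedSums.
Variables (R : realType) (I : choiceType).
Local Notation C := R[i].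

Lemma big_fset_split (V : nmodType) (A B : {fset I}) (F : I -> V) :
  (A `<=` B)%fset ->
  \sum_(a <- B) F a = \sum_(a <- A) F a + \sum_(a <- (B `\` A)%fset) F a.
Proof.
move=> /fsubsetP AB; rewrite (bigID (mem A)) /= -big_filter -[X in _ + X]big_filter.
congr (_ + _); apply: perm_big; apply: uniq_perm; rewrite ?filter_uniq ?fset_uniq//.
  move=> a; rewrite mem_filter; apply/andP/idP => [[]//|aA].
  by split => //; apply: AB.
by move=> a; rewrite mem_filter in_fsetD.
Qed.

Lemma big_fset_le (A B : {fset I}) (F : I -> R) : (forall a, 0 <= F a) ->
  (A `<=` B)%fset -> \sum_(a <- A) F a <= \sum_(a <- B) F a.
Proof. by move=> F0 /big_fset_split->; rewrite lerDl sumr_ge0. Qed.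

Lemma summable_tail (g : I -> R) (M : R) : (forall a, 0 <= g a) ->
  (forall B : {fset I}, \sum_(a <- B) g a <= M) ->
  forall e, 0 < e -> exists A : {fset I}, forall B : {fset I},
    \sum_(a <- (B `\` A)%fset) g a <= e.
Proof.
move=> g0 gM e e0; pose S := range (fun B : {fset I} => \sum_(a <- B) g a).
have hS : has_sup S.
  by split; [exists (\sum_(a <- fset0) g a), fset0|exists M => _ [B _ <-]].
have [_ [A _ <-] hA] := sup_adherent e0 hS.
exists A => B.
have : \sum_(a <- (A `|` B)%fset) g a <= sup S.
  by apply: ub_le_sup; [case: hS|exists (A `|` B)%fset].
rewrite (big_fset_split _ (fsubsetUl A B)) (_ : (A `|` B) `\` A = B `\` A)%fset.
  by rewrite -/S in hA; lra.
by rewrite fsetDUl fsetDv fset0U.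
Qed.

Section Normed.
Variable V : completeNormedModType C.
Implicit Types (F G : I -> V) (l : V).

Definition has_usum F l := forall e : R, 0 < e ->
  exists A : {fset I}, forall B : {fset I}, (A `<=` B)%fset ->
    rnorm (l - \sum_(a <- B) F a) <= e.

Lemma has_usum_unique F l l' : has_usum F l -> has_usum F l' -> l = l'.
Proof.
move=> h h'; apply/eqP; rewrite -subr_eq0; apply/eqP/rnorm_eps => e e0.
have e2 : 0 < e / 2 by rewrite divr_gt0.
have [A hA] := h _ e2; have [B hB] := h' _ e2.
rewrite (le_trans (rnormB_tri (\sum_(a <- (A `|` B)%fset) F a) _ _))//.
have := hA _ (fsubsetUl A B); have := hB _ (fsubsetUr A B); lra.
Qed.

Lemma has_usumP (a : C) F G l k : has_usum F l -> has_usum G k ->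
  has_usum (fun i => a *: F i + G i) (a *: l + k).
Proof.
move=> h h' e e0; have e2 : 0 < e / 2 by rewrite divr_gt0.
have a0 := Re_norm_ge0 a.
have [A hA] := h _ (divr_gt0 e2 (ltr_wpDl a0 (ltr01 : 0 < 1 :> R))).
have [B hB] := h' _ e2.
exists (A `|` B)%fset => S; rewrite fsubUset => /andP[AS BS].
rewrite big_split -scaler_sumr /= opprD addrACA -scalerBr.
rewrite (le_trans (rnormD _ _))// rnormZ.
have := hB _ BS; have := hA _ AS; have := rnorm_ge0 (l - \sum_(a <- S) F a).
set x := rnorm _; set y := rnorm _ => x0.
rewrite ler_pdivlMr ?ltr_wpDl//; lra.
Qed.

Lemma eq_has_usum F G l : F =1 G -> has_usum F l -> has_usum G l.
Proof. by move=> /funext->. Qed.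

Lemma has_usum_tail F l : has_usum F l -> forall e, 0 < e ->
  exists A : {fset I}, forall B : {fset I},
    rnorm (\sum_(a <- (B `\` A)%fset) F a) <= e.
Proof.
move=> h e e0; have [A hA] := h (e / 2) ltac:(by rewrite divr_gt0).
exists A => B.
have := hA _ (fsubset_refl A); have := hA _ (fsubsetUl A B).
rewrite (big_fset_split _ (fsubsetUl A B)) (_ : (A `|` B) `\` A = B `\` A)%fset; last first.
  by rewrite fsetDUl fsetDv fset0U.
set s := \sum_(a <- A) F a; set d := \sum_(a <- _) F a => h1 h2.
rewrite (_ : d = (l - s) - (l - (s + d))).
  rewrite (le_trans (rnormB_tri 0 _ _))// !subr0; lra.
by rewrite opprB [RHS]addrC addrA subrK addrAC subrr add0r.
Qed.

Lemma has_usum_ex F : (forall e, 0 < e ->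
  exists A : {fset I}, forall B : {fset I},
    rnorm (\sum_(a <- (B `\` A)%fset) F a) <= e) -> exists l, has_usum F l.
Proof.
move=> h.
have [e e0|l lP] := @rnorm_cauchy_cvg _ _ _ (@summability.totally I)
    (summability.totally_filter (I := I)) (fun B => \sum_(a <- B) F a).
  have [A hA] := h (e / 2) ltac:(by rewrite divr_gt0).
  exists [set B | (A `<=` B)%fset] => [|S T /= AS AT]; first by exists A.
  rewrite (le_trans (rnormB_tri (\sum_(a <- A) F a) _ _))//.
  rewrite (big_fset_split _ AS) (big_fset_split _ AT) !(addrAC _ _ (- _)) subrr !add0r.
  have := hA S; have := hA T; lra.
exists l => e e0; have [A _ hA] := lP _ e0.
by exists A => B AB; rewrite rnorm_distC; exact: hA.
Qed.

Lemma has_usum_abs F (g : I -> R) (M : R) : (forall a, rnorm (F a) <= g a) ->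
  (forall B : {fset I}, \sum_(a <- B) g a <= M) -> exists l, has_usum F l.
Proof.
move=> Fg gM; apply: has_usum_ex => e e0.
have g0 a : 0 <= g a by rewrite (le_trans (rnorm_ge0 _) (Fg a)).
have [A hA] := summable_tail g0 gM e0; exists A => B.
by rewrite (le_trans _ (hA B))// (le_trans (rnorm_sum _ _ _))// ler_sum.
Qed.

End Normed.
End UnorderedSums.

Section PolynomialCoefficients.
Variables (R : realType) (V : normedModType R[i]).

(** The constant term is [O(t)], hence 0, and dividing by [t] lowers [N]. Allowing a remainder
    [K t^N] makes the lemma usable on truncations of infinite expansions. *)
Lemma small_coefs0 N (c : nat -> V) (K d : R) : 0 < d ->
  (forall t : R, 0 < t < d ->
     rnorm (\sum_(k < N) (t%:C%C ^+ k) *: c k) <= K * t ^+ N) ->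
  forall k, (k < N)%N -> c k = 0.
Proof.
move=> d0; elim: N c => [//|N IH] c h.
pose s t := \sum_(k < N) (t%:C%C ^+ k) *: c k.+1.
have sE t : \sum_(k < N.+1) (t%:C%C ^+ k) *: c k = c 0%N + t%:C%C *: s t.
  rewrite big_ord_recl expr0 scale1r; congr (_ + _).
  by rewrite scaler_sumr; apply: eq_bigr => k _; rewrite scalerA -exprS.
have c0 : c 0%N = 0.
  pose M := `|K| + \sum_(k < N) rnorm (c k.+1).
  have M0 : 0 <= M by rewrite addr_ge0 ?sumr_ge0// => *; exact: rnorm_ge0.
  apply: rnorm_eps => e e0.
  pose t := Order.min (Order.min (d / 2) 1) (e / (M + 1)).
  have M1 : 0 < M + 1 by lra.
  have t0 : 0 < t by rewrite !lt_min ltr01 !divr_gt0.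
  have td : t < d by rewrite !gt_min; apply/orP; left; apply/orP; left; lra.
  have t1 : t <= 1 by rewrite !ge_min lexx orbT.
  have te : t * (M + 1) <= e by rewrite -ler_pdivlMr// !ge_min lexx orbT.
  have := h t; rewrite t0 td => /(_ isT); rewrite sE => ht.
  have st : rnorm (s t) <= \sum_(k < N) rnorm (c k.+1).
    rewrite (le_trans (rnorm_sum _ _ _))// ler_sum// => k _.
    rewrite -rmorphXn rnormZr ?exprn_ge0 ?(ltW t0)// ler_piMl ?rnorm_ge0//.
    by rewrite exprn_ile1 ?(ltW t0).
  have : rnorm (c 0%N) <= t * M.
    rewrite -{1}[c 0%N](addrK (t%:C%C *: s t)) (le_trans (rnormB_tri 0 _ _))// !subr0.
    rewrite (le_trans (lerD ht (lexx _)))// rnormZr ?(ltW t0)// exprS mulrCA mulrDr.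
    rewrite lerD ?ler_pM2l// (le_trans (ler_norm _))// normrM ler_piMr//.
    by rewrite ger0_norm ?exprn_ge0 ?exprn_ile1 ?(ltW t0).
  nra.
case=> [//|k] kN; apply: (IH (fun k => c k.+1)) => // t /[dup] ht /andP[t0 _].
have := h t ht; rewrite sE c0 add0r rnormZr ?(ltW t0)// exprS mulrCA.
by rewrite ler_pM2l.
Qed.

Lemma exponents_coefs0 (I : choiceType) (S : {fset I}) (ex : I -> nat) (c : I -> V) (d : R) :
  0 < d -> {in S &, injective ex} ->
  (forall t : R, 0 < t < d -> \sum_(a <- S) (t%:C%C ^+ ex a) *: c a = 0) ->
  forall a, a \in S -> c a = 0.
Proof.
move=> d0 exI h a aS.
pose N := (\max_(b <- S) ex b).+1.
have exN b : b \in S -> (ex b < N)%N by move=> bS; rewrite ltnS; apply: leq_bigmax_seq.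
pose c' j := \sum_(b <- S | ex b == j) c b.
have : c' (ex a) = 0.
  apply: (@small_coefs0 N c' 0 d d0) (exN _ aS) => t td.
  rewrite mul0r (_ : \sum_(k < N) _ = 0) ?rnorm0// -{2}(h t td).
  transitivity (\sum_(k < N) \sum_(b <- S | ex b == k) t%:C%C ^+ ex b *: c b).
    apply: eq_bigr => k _; rewrite scaler_sumr; apply: eq_bigr => b /eqP <- //.
  rewrite (exchange_big_dep predT)//= big_seq [RHS]big_seq; apply: eq_bigr => b bS.
  rewrite (bigD1 (Ordinal (exN b bS)))//= big1 ?addr0// => k /andP[/eqP bk].
  by rewrite -val_eqE /= -bk eqxx.
rewrite /c' big_mkcond (big_fsetD1 a)//= eqxx big_seq big1 ?addr0// => b.
rewrite !inE => /andP[ba bS]; case: eqP => // eab.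
by move: ba; rewrite (exI _ _ bS aS eab) eqxx.
Qed.

End PolynomialCoefficients.

(** * Multi-indices *)

Section Multiindices.
Variable n : nat.
Local Notation mi := (multiindex n).
Implicit Types a b : mi.

Definition deg a : nat := \sum_i a i.
Definition eadd (i : 'I_n) a : mi := [ffun j => (a j + (j == i))%N].
(** Meaningful only for [0 < a i]; when [a i = 0] the truncated subtraction returns [a] itself. *)
Definition esub (i : 'I_n) a : mi := [ffun j => (a j - (j == i))%N].
Definition mfact a : nat := \prod_i (a i)`!.
Definition mzero : mi := [ffun=> 0%N].

Lemma eaddK i : cancel (eadd i) (esub i).
Proof. by move=> a; apply/ffunP => j; rewrite !ffunE addnK. Qed.

Lemma esubK i a : (0 < a i)%N -> eadd i (esub i a) = a.
Proof.
move=> ai; apply/ffunP => j; rewrite !ffunE; have [->|_] := eqVneq; first by rewrite subnK.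
by rewrite subn0 addn0.
Qed.

Lemma eadd_inj i : injective (eadd i).
Proof. exact: can_inj (eaddK i). Qed.

Lemma eadd_gt0 i a : (0 < eadd i a i)%N.
Proof. by rewrite ffunE eqxx addn1. Qed.

Lemma deg_eadd i a : deg (eadd i a) = (deg a).+1.
Proof.
rewrite /deg (eq_bigr (fun j => a j + (j == i))%N) => [|j _]; last by rewrite ffunE.
rewrite big_split /= -[RHS]addn1; congr (_ + _)%N.
by rewrite (bigD1 i)//= eqxx big1// => j /negPf->.
Qed.

Lemma mfact_eadd i a : mfact (eadd i a) = ((a i).+1 * mfact a)%N.
Proof.
rewrite /mfact (bigD1 i)//= [in RHS](bigD1 i)//= mulnA ffunE eqxx addn1 factS.
by congr (_ * _)%N; apply: eq_bigr => j /negPf ji; rewrite ffunE ji addn0.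
Qed.

Lemma mfact_gt0 a : (0 < mfact a)%N.
Proof. by apply: prodn_gt0 => i; exact: fact_gt0. Qed.

Lemma deg_eq0 a : deg a = 0%N -> a = mzero.
Proof.
move=> /eqP; rewrite /deg sum_nat_eq0 => /forallP h; apply/ffunP => i.
by rewrite ffunE; apply/eqP; exact: h.
Qed.

Lemma deg_mzero : deg mzero = 0%N.
Proof. by rewrite /deg big1// => i; rewrite ffunE. Qed.

Lemma deg_gt0 a : (0 < deg a)%N -> exists i, (0 < a i)%N.
Proof.
rewrite lt0n sum_nat_eq0 negb_forall => /existsP[i /=]; rewrite -lt0n => ai.
by exists i.
Qed.

Lemma mi_ind (P : mi -> Prop) : P mzero -> (forall i a, P a -> P (eadd i a)) ->
  forall a, P a.
Proof.
move=> P0 PS a; have [k] := ubnP (deg a); elim: k a => // k IH a; rewrite ltnS => ak.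
have [/deg_eq0->//|d0] := posnP (deg a).
have [i ai] := deg_gt0 d0; rewrite -(esubK ai); apply/PS/IH.
by rewrite -ltnS -(deg_eadd i) esubK.
Qed.

Lemma leq_deg a i : (a i <= deg a)%N.
Proof. by rewrite /deg (bigD1 i)//= leq_addr. Qed.

Definition mdeg k : {fset mi} :=
  [fset a : mi in [seq [ffun i => f i : nat] | f : {ffun 'I_n -> 'I_k.+1}] | deg a == k]%fset.

Lemma in_mdeg k a : (a \in mdeg k) = (deg a == k).
Proof.
rewrite !inE /=; apply: andb_idl => /eqP ak; apply/mapP.
have h i : (a i < k.+1)%N by rewrite ltnS -ak leq_deg.
exists [ffun i => Ordinal (h i)]; first by rewrite mem_enum.
by apply/ffunP => i; rewrite !ffunE.
Qed.

(** These sets are cofinal among the finite sets of indices, so unordered sums can be tested on sums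
    by degree. *)
Fixpoint mlt k : {fset mi} := if k is k'.+1 then (mlt k' `|` mdeg k')%fset else fset0.

Lemma in_mlt k a : (a \in mlt k) = (deg a < k)%N.
Proof.
by elim: k => [|k IH] /=; rewrite ?in_fset0// in_fsetU IH in_mdeg ltnS [RHS]leq_eqVlt orbC.
Qed.

Lemma big_mlt (V : nmodType) (F : mi -> V) k :
  \sum_(a <- mlt k) F a = \sum_(j < k) \sum_(a <- mdeg j) F a.
Proof.
elim: k => [|k IH]; first by rewrite big_ord0 big_seq_fset0.
rewrite big_ord_recr -IH (big_fset_split _ (fsubsetUl (mlt k) (mdeg k))) /=.
congr (_ + _); congr (\sum_(a <- _) _); congr enum_fset; apply/fsetP => a.
rewrite in_fsetD in_fsetU in_mlt in_mdeg; case: eqP => [->|]; first by rewrite ltnn orbT.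
by case: ltnP.
Qed.

Lemma sub_mlt (B : {fset mi}) : exists k, (B `<=` mlt k)%fset.
Proof.
exists (\max_(a <- B) deg a).+1; apply/fsubsetP => a aB.
by rewrite in_mlt ltnS; apply: leq_bigmax_seq.
Qed.

Lemma big_mdeg_eadd (V : nmodType) (f : mi -> V) i k :
  \sum_(b <- mdeg k.+1 | (0 < b i)%N) f b = \sum_(a <- mdeg k) f (eadd i a).
Proof.
rewrite -big_filter -(big_map (eadd i) xpredT f).
apply: perm_big; apply: uniq_perm; rewrite ?filter_uniq ?fset_uniq//.
  by rewrite map_inj_uniq ?fset_uniq//; exact: eadd_inj.
move=> b; rewrite mem_filter in_mdeg; apply/andP/mapP => [[bi /eqP bk]|[a]].
  exists (esub i b); rewrite ?esubK// in_mdeg -eqSS -(deg_eadd i) esubK//.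
  exact/eqP.
by rewrite in_mdeg => /eqP ak ->; rewrite eadd_gt0 deg_eadd ak.
Qed.

(** Write [k+1] as [sum_i b_i]: then [b_i / b!] is [1 / (b - e_i)!], and [b - e_i] runs over the
    indices of degree [k]. This is the induction step of the multinomial theorem. *)
Lemma sum_mdegS (K : numFieldType) (V : lmodType K) (F : mi -> V) k :
  k.+1%:R *: \sum_(b <- mdeg k.+1) (mfact b)%:R^-1 *: F b =
  \sum_i \sum_(a <- mdeg k) (mfact a)%:R^-1 *: F (eadd i a).
Proof.
transitivity (\sum_(b <- mdeg k.+1) \sum_(i : 'I_n) ((b i)%:R / (mfact b)%:R) *: F b).
  rewrite scaler_sumr big_seq [RHS]big_seq; apply: eq_bigr => b.
  rewrite in_mdeg => /eqP <-; rewrite scalerA -scaler_suml; congr (_ *: _).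
  by rewrite -mulr_suml -natr_sum.
rewrite exchange_big; apply: eq_bigr => i _ /=.
rewrite (bigID (fun b : mi => 0 < b i)%N) /= addrC big1 ?add0r; last first.
  by move=> b; rewrite -eqn0Ngt => /eqP->; rewrite mul0r scale0r.
rewrite big_mdeg_eadd; apply: eq_bigr => a _; congr (_ *: _).
rewrite mfact_eadd ffunE eqxx addn1 natrM invfM mulrA divff ?mul1r// pnatr_eq0.
Qed.

(** Reduction modulo [k] gives the digit of index 0; cancelling it and dividing by [k] leaves one
    digit fewer. *)
Lemma base_expansion_inj k (a b : 'I_n -> nat) :
  (forall i, a i < k)%N -> (forall i, b i < k)%N ->
  (\sum_(i < n) a i * k ^ i = \sum_(i < n) b i * k ^ i)%N -> a =1 b.
Proof.
elim: n a b => [|p IH] a b ak bk; first by move=> _ [].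
rewrite !big_ord_recl /= !expn0 !muln1.
have sE (c : 'I_p.+1 -> nat) :
    (\sum_(i < p) c (lift ord0 i) * k ^ bump 0 i =
     k * \sum_(i < p) c (lift ord0 i) * k ^ i)%N.
  by rewrite big_distrr /=; apply: eq_bigr => i _; rewrite /bump add1n expnS mulnCA.
rewrite !sE => h.
have k0 : (0 < k)%N by rewrite (leq_ltn_trans _ (ak ord0)).
have h0 : a ord0 = b ord0.
  by move/(congr1 (modn^~ k)) : h; rewrite !(addnC _ (k * _)%N) !(mulnC k) !modnMDl !modn_small.
have /IH h1 : (\sum_(i < p) a (lift ord0 i) * k ^ i = \sum_(i < p) b (lift ord0 i) * k ^ i)%N.
  by move/eqP : h; rewrite h0 eqn_add2l eqn_pmul2l// => /eqP.
by move=> i; case: (unliftP ord0 i) => [j ->|->//]; exact: h1.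
Qed.

End Multiindices.

(** * Monomials and the multinomial theorem *)

Section Monomials.
Variables (R : realType) (n : nat).
Local Notation C := R[i].
Local Notation mi := (multiindex n).
Implicit Types (a b : mi) (z : 'rV[C]_n).

Lemma monomial_eadd z i a : monomial z (eadd i a) = z 0 i * monomial z a.
Proof.
rewrite /monomial (bigD1 i)//= [in RHS](bigD1 i)//= mulrA ffunE eqxx addn1 exprS.
by congr (_ * _); apply: eq_bigr => j /negPf ji; rewrite ffunE ji addn0.
Qed.

Lemma monomialZ (t : C) z a : monomial (t *: z) a = t ^+ deg a * monomial z a.
Proof.
rewrite /monomial /deg -prodrXr -big_split /=; apply: eq_bigr => i _.
by rewrite mxE exprMn.
Qed.

Lemma euclid_normE z : euclid_norm z = (Num.sqrt (\sum_i Re `|z 0 i| ^+ 2))%:C%C.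
Proof.
rewrite /euclid_norm; have -> : \sum_i `|z 0 i| ^+ 2 = (\sum_i Re `|z 0 i| ^+ 2)%:C%C.
  rewrite rmorph_sum; apply: eq_bigr => i _.
  by rewrite -[in LHS](RRe_real (normr_real (z 0 i))) -rmorphXn.
have x0 : 0 <= \sum_i Re `|z 0 i| ^+ 2 by rewrite sumr_ge0// => i _; exact: sqr_ge0.
by rewrite -{1}(sqr_sqrtr x0) rmorphXn /= sqrCK// ler0c sqrtr_ge0.
Qed.

Lemma euclid_norm_lt z (d : R) : 0 < d ->
  (euclid_norm z < d%:C%C) = (\sum_i Re `|z 0 i| ^+ 2 < d ^+ 2).
Proof.
move=> d0; rewrite euclid_normE ltcR -[X in _ < X](ger0_norm (ltW d0)).
by rewrite -sqrtr_sqr ltr_sqrt// exprn_gt0.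
Qed.

Lemma euclid_norm_lt1 z : (euclid_norm z < 1) = (\sum_i Re `|z 0 i| ^+ 2 < 1).
Proof. by rewrite (_ : 1 = 1%:C%C)// euclid_norm_lt// expr1n. Qed.

(* Kronecker substitution: [z_i = t ^ (k+1)^i] separates the monomials of degree [k]. *)
Lemma monomial_coefs0 (V : normedModType C) k (c : mi -> V) (d : R) : 0 < d ->
  (forall z, euclid_norm z < d%:C%C -> \sum_(a <- mdeg n k) monomial z a *: c a = 0) ->
  forall a, deg a = k -> c a = 0.
Proof.
move=> d0 h a ak; pose ex (b : mi) := (\sum_(i < n) b i * k.+1 ^ i)%N.
have n1 : 0 < n.+1%:R :> R by [].
(* For [t < 1] every coordinate [t ^ (k+1)^i] is at most [t], so the squared norm of [z] is at most
   [n t^2], which is below [d^2] once [t (n+1) < d]. *)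
apply: (@exponents_coefs0 _ _ _ (mdeg n k) ex c (Order.min 1 (d / n.+1%:R))).
- by rewrite lt_min ltr01 divr_gt0.
- move=> b b'; rewrite !in_mdeg => /eqP bk /eqP b'k /base_expansion_inj e.
  by apply/ffunP; apply: e => i; rewrite ltnS; [rewrite -bk|rewrite -b'k]; exact: leq_deg.
- move=> t /andP[t0]; rewrite lt_min => /andP[t1]; rewrite ltr_pdivlMr// => tn.
  pose z : 'rV[C]_n := \row_i t%:C%C ^+ (k.+1 ^ i).
  rewrite -[RHS](h z); last first.
    rewrite euclid_norm_lt//; apply: (@le_lt_trans _ _ (\sum_(i < n) t ^+ 2)).
      apply: ler_sum => i _; rewrite mxE -rmorphXn ger0_norm ?ler0c ?exprn_ge0 ?(ltW t0)//=.
      rewrite -exprM; apply: ler_wiXn2l; rewrite ?ltW// muln2 -addnn.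
      by rewrite -[2%N]/(1 + 1)%N leq_add// expn_gt0.
    rewrite sumr_const card_ord -mulr_natl.
    have nn : 0 <= n%:R :> R by [].
    have tn2 : (t * n.+1%:R) ^+ 2 < d ^+ 2.
      by rewrite ltr_pXn2r ?nnegrE ?mulr_ge0 ?(ltW t0) ?(ltW d0).
    apply: le_lt_trans tn2; rewrite exprMn mulrC ler_wpM2l ?sqr_ge0// -natr1; nra.
  apply: eq_bigr => b _; congr (_ *: _).
  rewrite /monomial /ex -prodrXr; apply: eq_bigr => i _.
  by rewrite mxE -exprM mulnC.
- by rewrite in_mdeg ak.
Qed.

(* The multinomial theorem, with [F a] in the role of [X ^ a w]. *)
Lemma iter_linear_comb (K : numFieldType) (V : lmodType K) (F : mi -> V)
    (X : 'I_n -> {linear V -> V}) (s : 'I_n -> K) k :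
  (forall i a, X i (F a) = F (eadd i a)) ->
  iter k (fun v => \sum_i s i *: X i v) (F (mzero n)) =
  k`!%:R *: \sum_(a <- mdeg n k) ((\prod_i s i ^+ a i) / (mfact a)%:R) *: F a.
Proof.
move=> XF; elim: k => [|k IH].
  rewrite fact0 scale1r /= (_ : mdeg n 0 = [fset mzero n]%fset).
    rewrite big_seq_fset1 big1 => [|i _]; last by rewrite ffunE expr0.
    by rewrite /mfact big1 ?divr1 ?scale1r// => i _; rewrite ffunE.
  apply/fsetP => a; rewrite in_mdeg in_fset1.
  by apply/eqP/eqP => [/deg_eq0//|->]; rewrite deg_mzero.
rewrite iterS IH factS natrM mulrC -scalerA.
pose G (a : mi) := (\prod_i s i ^+ a i) *: F a.
rewrite (eq_bigr (fun a => (mfact a)%:R^-1 *: G a)) => [|a _]; last first.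
  by rewrite /G scalerA mulrC.
rewrite [in RHS](eq_bigr (fun a => (mfact a)%:R^-1 *: G a)) => [|a _]; last first.
  by rewrite /G scalerA mulrC.
rewrite sum_mdegS [RHS]scaler_sumr; apply: eq_bigr => i _.
rewrite linearZ linear_sum /= scalerA mulrC -scalerA; congr (_ *: _).
rewrite scaler_sumr; apply: eq_bigr => a _.
rewrite /G !linearZ /= XF !scalerA; congr (_ *: _).
rewrite mulrC [X in _ * X]mulrC mulrA; congr (_ / _).
rewrite (bigD1 i)//= [in RHS](bigD1 i)//= mulrA.
rewrite ffunE eqxx addn1 exprS; congr (_ * _).
by apply: eq_bigr => j /negPf ji; rewrite ffunE ji addn0.
Qed.

(** The case of [iter_linear_comb] where the space is [K] itself, every [X i] is the identity and
    [F] is constantly 1. *)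
Lemma multinomial (K : numFieldType) (s : 'I_n -> K) k :
  \sum_(a <- mdeg n k) (k`!%:R / (mfact a)%:R) * \prod_i s i ^+ a i =
  (\sum_i s i) ^+ k.
Proof.
have := @iter_linear_comb K K^o (fun=> 1) (fun=> idfun) s k (fun _ _ => erefl).
rewrite (_ : iter k _ _ = (\sum_i s i) ^+ k).
  move->; rewrite [RHS]mulr_sumr; apply: eq_bigr => a _.
  by rewrite scaler1 mulrA mulrAC.
elim: k => [//|k IH]; rewrite iterS IH exprS mulr_suml.
by apply: eq_bigr.
Qed.

End Monomials.

(** * Coefficients of the negative binomial series *)

Section NegativeBinomial.

(** Coefficient of [q^k] in [(1 - q)^-m]. With the truncated predecessor it is correct for [m = 0]
    too: 1 for [k = 0], otherwise 0. *)
Definition nbin m k := 'C((m + k).-1, k).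

Lemma nbin0 m : nbin m 0 = 1%N.
Proof. by rewrite /nbin bin0. Qed.

Lemma nbin0S k : nbin 0 k.+1 = 0%N.
Proof. by rewrite /nbin add0n bin_small. Qed.

Lemma nbinS m k : nbin m.+1 k.+1 = (nbin m k.+1 + nbin m.+1 k)%N.
Proof. by rewrite /nbin addnS addSn /= binS addnS. Qed.

Lemma nbin_gt0 m k : (0 < m)%N -> (0 < nbin m k)%N.
Proof. by case: m => // m _; rewrite /nbin bin_gt0 addSn leq_addl. Qed.

(** Pascal's rule splits the sum for [m+1] into the sum for [m] and [q] times a shorter sum, and the
    bound [B = (1-q)^-(m+1)] satisfies [B = (1-q)^-m + q B]. *)
Lemma nbin_series_le (R : realFieldType) (q : R) m M : 0 <= q < 1 ->
  \sum_(k < M) (nbin m k)%:R * q ^+ k <= (1 - q)^-1 ^+ m.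
Proof.
move=> /andP[q0 q1]; have p0 : 0 < 1 - q by rewrite subr_gt0.
elim: m M => [|m IH] M.
  case: M => [|M]; rewrite expr0 ?big_ord0// big_ord_recl nbin0 expr0 mulr1.
  by rewrite big1 ?addr0// => k _; rewrite nbin0S mul0r.
elim: M => [|M IHM]; first by rewrite big_ord0 exprn_ge0// invr_ge0 ltW.
have h : \sum_(k < M.+1) (nbin m.+1 k)%:R * q ^+ k =
    \sum_(k < M.+1) (nbin m k)%:R * q ^+ k + q * \sum_(k < M) (nbin m.+1 k)%:R * q ^+ k.
  rewrite !big_ord_recl !nbin0 -addrA; congr (_ + _).
  rewrite mulr_sumr -big_split /=; apply: eq_bigr => k _.
  by rewrite /bump add1n nbinS natrD exprS; ring.
rewrite h; have := IH M.+1; rewrite [in X in _ -> X]exprS.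
have -> : (1 - q)^-1 * (1 - q)^-1 ^+ m = (1 - q)^-1 ^+ m + q * ((1 - q)^-1 * (1 - q)^-1 ^+ m).
  by field; rewrite gt_eqF.
by move=> h1; rewrite lerD// ler_wpM2l// -exprS.
Qed.

End NegativeBinomial.

(** * The weights of the kernel *)

Section Rho.
Variables (R : realType) (n m : nat).
Hypothesis m_gt0 : (0 < m)%N.
Local Notation mi := (multiindex n).

Lemma rhoE (a : mi) :
  rho R m a = (nbin m (deg a))%:R * ((deg a)`!)%:R / (mfact a)%:R.
Proof.
rewrite /rho -/(deg a) -/(mfact a) /nbin natrM invfM mulrA mulrAC; congr (_ / _).
case: m m_gt0 => // p _; rewrite addSn /=.
have p0 : p`!%:R != 0 :> R by rewrite pnatr_eq0 -lt0n fact_gt0.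
apply: (mulIf p0); rewrite divfK// -!natrM; congr (_%:R).
by rewrite -(bin_fact (leq_addl p (deg a))) addnK mulnA.
Qed.

Lemma rho_gt0 (a : mi) : 0 < rho R m a.
Proof.
by rewrite rhoE divr_gt0 ?mulr_gt0 ?ltr0n ?nbin_gt0 ?fact_gt0 ?mfact_gt0.
Qed.

Lemma rho0 : rho R m (mzero n) = 1.
Proof.
rewrite rhoE deg_mzero nbin0 fact0 mul1r /mfact big1 ?divr1// => i _.
by rewrite ffunE.
Qed.

(** Each [rho(a - e_i)] is a common factor times [a_i / a!], and the [a_i] add up to [k+1]. Because
    the resulting ratio depends only on the degree, [sigma] preserves diagonal operators on
    [H_m]. *)
Lemma sum_rho_esub (a : mi) k : deg a = k.+1 ->
  (nbin m k.+1)%:R * \sum_(i | (0 < a i)%N) rho R m (esub i a) = (nbin m k)%:R * rho R m a.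
Proof.
move=> ak.
transitivity ((nbin m k.+1)%:R * \sum_i (nbin m k)%:R * (k`!)%:R * (a i)%:R / (mfact a)%:R : R).
  congr (_ * _); rewrite [RHS](bigID (fun i => 0 < a i)%N) /= [X in _ + X]big1 ?addr0; last first.
    by move=> i; rewrite -eqn0Ngt => /eqP->; rewrite mulr0 mul0r.
  apply: eq_bigr => i ai; rewrite rhoE.
  have := deg_eadd i (esub i a); rewrite esubK// ak => -[<-].
  have := mfact_eadd i (esub i a); rewrite esubK// => ->.
  rewrite ffunE eqxx subn1 prednK// natrM invfM [in RHS]mulrA -!mulrA; congr (_ * (_ * _)).
  by rewrite mulrA divff ?mul1r// pnatr_eq0 -lt0n.
rewrite -mulr_suml -mulr_sumr -natr_sum -/(deg a) ak rhoE ak factS natrM; ring.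
Qed.

End Rho.

(** * Power series on the ball *)

Section PowerSeries.
Variables (R : realType) (n : nat).
Local Notation C := R[i].
Local Notation mi := (multiindex n).
Variable D : hilbertType C.
Implicit Types (f g : unit_ball R n -> D) (c : mi -> D).

Lemma power_seriesP f c : power_series f c <->
  forall z, has_usum (fun a => monomial (sval z) a *: c a) (f z).
Proof.
split=> h z e e0.
  have [|A hA] := h z e%:C%C; first by rewrite ltcR.
  by exists A => B /hA; rewrite rnormE ltcR => /ltW.
have := e0; rewrite ltcE => /andP[/eqP /= ie0 re0].
have eE : e = (Re e)%:C%C by rewrite -[LHS]RRe_real// gtr0_real.
have [|A hA] := h z (Re e / 2); first by rewrite divr_gt0.
exists A => B /hA; rewrite eE rnormE ltcR; lra.
Qed.

(** Along the ray [t z] the series becomes a power series in [t] whose coefficients are the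
    homogeneous parts. Summability bounds these, so the tail after degree [k] is [O(t^(k+1))] and
    [small_coefs0] applies. *)
Lemma power_series0 c :
  (forall z : unit_ball R n, has_usum (fun a => monomial (sval z) a *: c a) 0) ->
  forall a, c a = 0.
Proof.
move=> h a.
suff hk k z : euclid_norm z < 1 -> \sum_(b <- mdeg n k) monomial z b *: c b = 0.
  by apply: (@monomial_coefs0 _ _ _ _ c 1 _ (hk (deg a))).
move=> z1; pose s j := \sum_(b <- mdeg n j) monomial z b *: c b.
have zt (t : R) : 0 < t < 2^-1 -> euclid_norm (t%:C%C *: z) < 1.
  move=> /andP[t0 t2]; move: z1; rewrite !euclid_norm_lt1.
  apply: le_lt_trans; apply: ler_sum => i _; rewrite mxE normrM.
  rewrite -[ `|z 0 i|]RRe_real ?normr_real// ger0_norm ?ler0c ?(ltW t0)// -rmorphM /= exprMn.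
  rewrite ler_piMl ?sqr_ge0// exprn_ile1 ?(ltW t0)//; lra.
have [A hA] := has_usum_tail (h (exist _ z z1)) (ltr01 : 0 < 1 :> R).
have [k0 Ak0] := sub_mlt A.
(* Only finitely many degrees lie below [k0]; from [k0] on, the indices of degree [j] avoid [A], so
   [s j] has norm at most 1. *)
pose K := 1 + \sum_(j < k0) rnorm (s j).
have sK j : rnorm (s j) <= K.
  have [jk|kj] := ltnP j k0.
    rewrite /K (bigD1 (Ordinal jk))//= addrCA lerDl addr_ge0// sumr_ge0// => *.
    exact: rnorm_ge0.
  apply: (@le_trans _ _ 1); last by rewrite lerDl sumr_ge0// => *; exact: rnorm_ge0.
  have := hA (mdeg n j); rewrite (_ : (mdeg n j `\` A)%fset = mdeg n j)//.
  apply/fsetP => b; rewrite in_fsetD in_mdeg; case: eqP => bj; rewrite ?andbF// andbT.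
  apply/negP => /(fsubsetP Ak0); rewrite in_mlt bj ltnNge kj//.
have K0 : 0 <= K by rewrite (le_trans (rnorm_ge0 _) (sK 0%N)).
apply: (@small_coefs0 _ _ k.+1 s (2 * K) (2^-1)) => // t t01.
have /andP[t0 t2] := t01.
apply/ler_addgt0Pr => e e0.
have [A' hA'] := h (exist (fun z => is_true (euclid_norm z < 1)) _ (zt t t01)) e e0.
have [M0 AM0] := sub_mlt A'; pose M := maxn M0 k.+1.
have AM : (A' `<=` mlt n M)%fset.
  apply/fsubsetP => b /(fsubsetP AM0); rewrite !in_mlt => /leq_trans; apply.
  exact: leq_maxl.
have := hA' _ AM; rewrite sub0r rnormN big_mlt.
under eq_bigr => j _.
  rewrite (_ : \sum_(b <- _) _ = t%:C%C ^+ j *: s j); last first.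
    rewrite scaler_sumr big_seq [RHS]big_seq; apply: eq_bigr => b.
    by rewrite in_mdeg => /eqP <-; rewrite /= monomialZ scalerA.
  over.
rewrite -(big_mkord xpredT (fun j => t%:C%C ^+ j *: s j)) (@big_cat_nat _ _ _ k.+1)//=;
  last exact: leq_maxr.
rewrite big_mkord => hM.
set u := \sum_(i < k.+1) _ in hM *; set v := \sum_(k.+1 <= i < M) _ in hM.
have hv : rnorm v <= 2 * K * t ^+ k.+1.
  rewrite (le_trans (rnorm_sum _ _ _))//.
  apply: (@le_trans _ _ (\sum_(k.+1 <= j < M) K * t ^+ j)).
    apply: ler_sum => j _; rewrite -rmorphXn rnormZr ?exprn_ge0 ?(ltW t0)// mulrC.
    by rewrite ler_wpM2r ?exprn_ge0 ?(ltW t0).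
  have : (\sum_(k.+1 <= j < M) K * t ^+ j) * (1 - t) = K * t ^+ k.+1 - K * t ^+ M.
    rewrite mulr_suml -[RHS]opprB -(telescope_sumr (fun j => K * t ^+ j)) ?leq_maxr// -sumrN.
    by apply: eq_bigr => j _; rewrite exprS; ring.
  have := exprn_ge0 M (ltW t0); have := exprn_ge0 k.+1 (ltW t0).
  have : 0 <= \sum_(k.+1 <= j < M) K * t ^+ j.
    by rewrite sumr_ge0// => j _; rewrite mulr_ge0 ?exprn_ge0 ?(ltW t0).
  move: (\sum_(_ <= _ < _) _) (t ^+ k.+1) (t ^+ M) => S p q S0 p0 q0 SE.
  have : 0 <= K * q by rewrite mulr_ge0.
  have : S * t <= S / 2 by rewrite ler_wpM2l// -[2^-1]div1r; lra.
  lra.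
rewrite -[u](addrK v) (le_trans (rnormB_tri 0 _ _))// !subr0; lra.
Qed.

Lemma power_series_unique f c c' : power_series f c -> power_series f c' -> c = c'.
Proof.
move=> /power_seriesP h /power_seriesP h'; apply/funext => a; apply/eqP.
rewrite -subr_eq0; apply/eqP.
rewrite addrC -scaleN1r.
apply: (@power_series0 (fun b => - 1 *: c' b + c b) _ a) => z.
have := has_usumP (-1) (h' z) (h z); rewrite scaleN1r addNr.
by apply: eq_has_usum => b; rewrite scalerDr !scalerA mulrC.
Qed.

Lemma taylor_coefE f c : power_series f c -> taylor_coef f = c.
Proof.
move=> h; apply: (power_series_unique _ (h)).
exact: (xgetPex (fun=> 0) (ex_intro [set c | power_series f c] c h)).
Qed.

Definition shift_coef i c : mi -> D := fun a => if a i is 0%N then 0 else c (esub i a).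

Lemma power_series_shift i f c : power_series f c ->
  power_series (mult_coord i f) (shift_coef i c).
Proof.
move=> /power_seriesP h; apply/power_seriesP => z e e0.
pose w := Re `|sval z 0 i| + 1.
have w0 : 0 < w by rewrite ltr_wpDl ?Re_norm_ge0.
have [A hA] := h z (e / w) (divr_gt0 e0 w0).
exists [fset eadd i a | a in A]%fset => B AB.
pose B' := [fset esub i b | b in B & (0 < b i)%N]%fset.
have AB' : (A `<=` B')%fset.
  apply/fsubsetP => a aA; apply/imfsetP; exists (eadd i a); rewrite ?eaddK//.
  rewrite !inE /= eadd_gt0 andbT; apply: (fsubsetP AB); exact: in_imfset.
have -> : \sum_(b <- B) monomial (sval z) b *: shift_coef i c b =
    sval z 0 i *: \sum_(a <- B') monomial (sval z) a *: c a.
  rewrite (bigID (fun b : mi => 0 < b i)%N) /= addrC big1 ?add0r; last first.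
    by move=> b; rewrite /shift_coef; case: (b i) => //; rewrite scaler0.
  rewrite big_imfset /=; last first.
    move=> a b; rewrite !unfold_in /= => /andP[_ a0] /andP[_ b0] /(congr1 (eadd i)).
    by rewrite !esubK.
  rewrite big_filter scaler_sumr; apply: eq_bigr => b bi.
  rewrite scalerA -monomial_eadd esubK// /shift_coef.
  by case: (b i) bi.
rewrite /mult_coord -scalerBr rnormZ.
apply: (@le_trans _ _ (w * (e / w))); last by rewrite mulrC divfK ?gt_eqF.
apply: ler_pM; rewrite ?Re_norm_ge0 ?rnorm_ge0 ?hA//.
by rewrite lerDl.
Qed.

(** Real form of [Hm_sqnorm m f <= M] for a series with coefficients [c], free of extended reals and
    of [taylor_coef]. *)
Definition norm_summable m c (M : R) := forall B : {fset mi},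
  \sum_(a <- B) rnorm (c a) ^+ 2 / rho R m a <= M.

(** By the inequality of means, [|z^a| |c_a|] is at most half of
    [rho(a) |z^a|^2 + |c_a|^2 / rho(a)]. The first terms sum to at most [(1 - |z|^2)^-m], the
    diagonal value of the kernel, by the multinomial theorem. *)
Lemma norm_summable_series m c M : (0 < m)%N -> norm_summable m c M ->
  exists f, power_series f c.
Proof.
move=> m0 cM.
suff h (z : unit_ball R n) : exists l, has_usum (fun a => monomial (sval z) a *: c a) l.
  by have [f fP] := choice h; exists f; apply/power_seriesP.
pose r i := Re `|sval z 0 i| ^+ 2; pose q := \sum_i r i.
have r0 i : 0 <= r i by exact: sqr_ge0.
have q1 : 0 <= q < 1.
  rewrite sumr_ge0//=; by have := svalP z; rewrite euclid_norm_lt1.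
pose g (a : mi) := rho R m a * \prod_i r i ^+ a i.
have gK (B : {fset mi}) : \sum_(a <- B) g a <= (1 - q)^-1 ^+ m.
  have [M' BM'] := sub_mlt B.
  have g0 a : 0 <= g a.
    rewrite mulr_ge0 ?(ltW (rho_gt0 _ _ _))// prodr_ge0// => i _; exact: exprn_ge0.
  rewrite (le_trans (big_fset_le g0 BM'))// big_mlt (le_trans _ (nbin_series_le m M' q1))//.
  apply: ler_sum => k _; rewrite -multinomial mulr_sumr.
  rewrite big_seq [leRHS]big_seq; apply: ler_sum => a; rewrite in_mdeg => /eqP ak.
  by rewrite /g rhoE// ak -!mulrA.
apply: (@has_usum_abs _ _ _ _ (fun a => (g a + rnorm (c a) ^+ 2 / rho R m a) / 2)
   (((1 - q)^-1 ^+ m + M) / 2)) => [a|B]; last first.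
  by rewrite -mulr_suml big_split /= ler_pM2r ?invr_gt0// lerD.
have rp := rho_gt0 R m0 a.
have -> : g a = rho R m a * (Re `|monomial (sval z) a|) ^+ 2.
  congr (_ * _); rewrite /monomial /r.
  have -> : `|\prod_(i < n) sval z 0 i ^+ a i| = (\prod_i Re `|sval z 0 i| ^+ a i)%:C%C.
    rewrite normr_prod rmorph_prod; apply: eq_bigr => i _.
    by rewrite normrX -[in LHS](RRe_real (normr_real (sval z 0 i))) -rmorphXn.
  rewrite /= -prodrXl; apply: eq_bigr => i _; by rewrite -!exprM mulnC.
rewrite rnormZ; move: (Re `|_|) (rnorm _) (rho _ _ _) rp => x y p p0.
have := sqr_ge0 (x * p - y); rewrite sqrrB => h.
rewrite ler_pdivlMr// -(ler_pM2r p0) mulrDl divfK ?gt_eqF//.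
by move: h; rewrite exprMn; lra.
Qed.

Lemma Hm_sqnorm_le m f c M : power_series f c -> norm_summable m c M ->
  (Hm_sqnorm m f <= M%:E)%E.
Proof.
move=> fc cM; rewrite /Hm_sqnorm (taylor_coefE fc); apply: ge_ereal_sup => _ [A [fA _] <-].
by rewrite fsbig_finite// sumEFin lee_fin; exact: cM.
Qed.

Lemma Hm_sqnorm_summable m f c M : power_series f c -> (Hm_sqnorm m f <= M%:E)%E ->
  norm_summable m c M.
Proof.
move=> fc fM B; rewrite -lee_fin; apply: le_trans fM.
rewrite /Hm_sqnorm (taylor_coefE fc); apply: esum_ge; exists [set` B] => //.
by rewrite fsbig_finite// set_fsetK sumEFin.
Qed.

Lemma Hm_sqnorm_ge0 m f : (0 < m)%N -> (0 <= Hm_sqnorm m f)%E.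
Proof.
move=> m0; apply: esum_ge0 => a _.
by rewrite lee_fin divr_ge0 ?sqr_ge0 ?(ltW (rho_gt0 _ _ _)).
Qed.

Lemma HmP m f : (0 < m)%N ->
  Hm m f <-> exists c M, power_series f c /\ norm_summable m c M.
Proof.
move=> m0; split => [[[c fc] foo]|[c [M [fc cM]]]].
  exists c, (fine (Hm_sqnorm m f)); split=> //; apply: (Hm_sqnorm_summable fc).
  by rewrite fineK// ge0_fin_numE ?Hm_sqnorm_ge0.
split; first by exists c.
exact: le_lt_trans (Hm_sqnorm_le fc cM) (ltry _).
Qed.

Lemma Hm_sqnorm_eq m f c M : (0 < m)%N -> power_series f c -> norm_summable m c M ->
  (forall e, 0 < e -> exists B : {fset mi},
     M - e <= \sum_(a <- B) rnorm (c a) ^+ 2 / rho R m a) ->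
  Hm_sqnorm m f = M%:E.
Proof.
move=> m0 fc cM h; apply/eqP; rewrite eq_le (Hm_sqnorm_le fc cM)/=.
have fin : Hm_sqnorm m f \is a fin_num.
  by rewrite ge0_fin_numE ?Hm_sqnorm_ge0// (le_lt_trans (Hm_sqnorm_le fc cM))// ltry.
have := @Hm_sqnorm_summable m f c (fine (Hm_sqnorm m f)) fc.
rewrite fineK// => /(_ (lexx _)) hs.
rewrite -(fineK fin) lee_fin; apply/ler_addgt0Pr => e e0; have [B hB] := h e e0.
by have := hs B; lra.
Qed.

End PowerSeries.

Section LinearPack.
Variables (K : pzRingType) (U V : lmodType K) (f : U -> V).
Hypothesis fL : linear f.
#[local] HB.instance Definition _ := GRing.isLinear.Build K U V _ f fL.

(** Bundles a map whose linearity is only established inside a proof, such as one obtained from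
    [choice]. *)
Lemma linear_pack : exists g : {linear U -> V}, g =1 f.
Proof. by exists f. Qed.

End LinearPack.

(** * Row contractions *)

Section RowContractions.
Variables (R : realType) (n : nat).
Local Notation C := R[i].
Variable H : hilbertType C.
Implicit Types (x y : H) (X Y : H -> H).

(** Testing against every [z] moves [X] onto the other argument, where only linearity of the form is
    used. Self-adjointness thus yields the linearity of [delta] and [defect]. *)
Lemma adjointable_linear X Y : (forall x y, hdot (X x) y = hdot x (Y y)) -> linear X.
Proof.
move=> XY a x y; apply: hdot_ext => z.
by rewrite XY !hdotDl !hdotZl !XY.
Qed.

Variable T : 'I_n -> bounded_operator H.

Lemma commuting_adjoint : commuting T ->
  forall i j x, adjoint (T i) (adjoint (T j) x) = adjoint (T j) (adjoint (T i) x).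
Proof.
by move=> cT i j x; apply: hdot_ext => y; rewrite -!adjointPr cT.
Qed.

Lemma wanderingP w : wandering T w <-> forall i, adjoint (T i) w = 0.
Proof.
split=> [h i|h _ [v _ <-]].
  apply: hdot_ext => x; rewrite hdot0l -adjointPr; apply: h.
  exists [ffun j => if j == i then x else 0] => //.
  rewrite /row_op (bigD1 i)//= ffunE eqxx big1 ?addr0// => j /negPf ji.
  by rewrite ffunE ji linear0.
by rewrite /row_op hdot_sumr big1// => i _; rewrite adjointPr h hdot0l.
Qed.

Lemma Re_hdot_row x :
  Re (hdot (\sum_i T i (adjoint (T i) x)) x) = \sum_i rnorm (adjoint (T i) x) ^+ 2.
Proof.
rewrite hdot_suml; under eq_bigr do rewrite adjointP hdotxx.
by rewrite -rmorph_sum.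
Qed.

Lemma sigma_lin N (a : 'I_N -> C) (X : 'I_N -> H -> H) x :
  sigma T (fun y => \sum_j a j *: X j y) x = \sum_j a j *: sigma T (X j) x.
Proof.
rewrite /sigma; under eq_bigr do rewrite linear_sum.
rewrite exchange_big; apply: eq_bigr => j _ /=.
by rewrite scaler_sumr; apply: eq_bigr => i _; rewrite linearZ.
Qed.

Lemma sigma_adjoint X Y : (forall x y, hdot (X x) y = hdot x (Y y)) ->
  forall x y, hdot (sigma T X x) y = hdot x (sigma T Y y).
Proof.
move=> XY x y; rewrite /sigma hdot_suml hdot_sumr; apply: eq_bigr => i _.
by rewrite adjointP XY adjointPr.
Qed.

Lemma iter_sigma_selfadjoint j x y :
  hdot (iter j (sigma T) idfun x) y = hdot x (iter j (sigma T) idfun y).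
Proof. by elim: j x y => // j IH x y; apply: sigma_adjoint. Qed.

Fixpoint defect l x : H :=
  if l is l'.+1 then defect l' x - sigma T (defect l') x else x.

(** The upper limit [N] is any number above [l], the additional binomials being 0; this freedom lets
    Pascal's rule match two sums of different length. *)
Lemma defectE l N : (l < N)%N -> forall x,
  defect l x = \sum_(j < N) ((-1) ^+ j * 'C(l, j)%:R) *: iter j (sigma T) idfun x.
Proof.
elim: l N => [|l IH] [//|N] lN x.
  rewrite big_ord_recl mul1r scale1r big1 ?addr0// => j _.
  by rewrite bin0n mulr0 scale0r.
have E : defect l = fun y =>
    \sum_(j < N) ((-1) ^+ j * 'C(l, j)%:R) *: iter j (sigma T) idfun y.
  by apply/funext => y; exact: IH.
rewrite /= (IH N.+1 (ltnW lN)) {1}E.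
rewrite sigma_lin !big_ord_recl -addrA; congr (_ + _).
  by rewrite !bin0.
rewrite -sumrB; apply: eq_bigr => j _ /=.
rewrite /bump add1n binS natrD mulrDr scalerDl; congr (_ + _).
by rewrite -scaleNr exprS mulN1r mulNr.
Qed.

Definition delta m x : H :=
  \sum_(j < m) ((-1) ^+ j * 'C(m, j.+1)%:R) *: iter j (sigma T) idfun x.

Lemma defect_delta m x : defect m x = x - sigma T (delta m) x.
Proof.
rewrite (defectE (ltnSn m)) big_ord_recl bin0 mul1r scale1r; congr (_ + _).
rewrite sigma_lin -sumrN; apply: eq_bigr => j _ /=.
by rewrite /bump add1n -scaleNr exprS mulN1r mulNr.
Qed.

Lemma delta_selfadjoint m x y : hdot (delta m x) y = hdot x (delta m y).
Proof.
rewrite hdot_suml hdot_sumr; apply: eq_bigr => j _.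
rewrite hdotZl hdotZr iter_sigma_selfadjoint; congr (_ * _).
by rewrite rmorphM rmorph_nat rmorphXn rmorphN1.
Qed.

Lemma delta_is_linear m : linear (delta m).
Proof. exact: adjointable_linear (delta_selfadjoint m). Qed.
HB.instance Definition _ m :=
  GRing.isLinear.Build C H H _ (delta m) (delta_is_linear m).

Lemma defect_selfadjoint l x y : hdot (defect l x) y = hdot x (defect l y).
Proof.
elim: l x y => //= l IH x y; rewrite hdotBl hdotBr IH; congr (_ - _).
exact: sigma_adjoint.
Qed.

Lemma defect_is_linear l : linear (defect l).
Proof. exact: adjointable_linear (defect_selfadjoint l). Qed.
HB.instance Definition _ l :=
  GRing.isLinear.Build C H H _ (defect l) (defect_is_linear l).

Lemma defect_wandering l w : (forall i, adjoint (T i) w = 0) -> defect l w = w.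
Proof.
move=> h; elim: l => //= l ->; rewrite /sigma big1 ?subr0// => i _.
by rewrite h !linear0.
Qed.

Lemma row_adjB x y : row_adj T (x - y) = row_adj T x - row_adj T y.
Proof. by apply/ffunP => i; rewrite !ffunE linearB. Qed.

Lemma row_opB h k : row_op T (h - k) = row_op T h - row_op T k.
Proof. by rewrite /row_op -sumrB; apply: eq_bigr => i _; rewrite !ffunE linearB. Qed.

(** [T^*T] is injective on [Im T^*]: if [T^*T T^*u = 0], pairing [TT^*u] with itself gives
    [TT^*u = 0], and pairing that with [u] gives [T^*u = 0]. *)
Lemma inv_TstarTK x :
  inv_TstarT T (row_adj T (row_op T (row_adj T x))) = row_adj T x.
Proof.
have inj : {in range (row_adj T) &, injective (row_adj T \o row_op T)}; last first.
  have := @pinvKV _ _ (fun=> 0) _ _ inj (row_adj T x); rewrite inE /=; apply.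
  by exists x.
move=> _ _ /set_mem[u _ <-] /set_mem[v _ <-] /= uv.
apply/eqP; rewrite -subr_eq0 -row_adjB; apply/eqP.
have /ffunP Sw : row_adj T (row_op T (row_adj T (u - v))) = 0.
  by rewrite row_adjB row_opB row_adjB uv subrr.
have r0 : row_op T (row_adj T (u - v)) = 0.
  apply: hdotxx_eq0; rewrite {2}/row_op hdot_sumr big1// => i _.
  by rewrite adjointPr; have := Sw i; rewrite !ffunE => ->; rewrite hdot0l.
have : \sum_i rnorm (adjoint (T i) (u - v)) ^+ 2 = 0.
  have rE : \sum_i T i (adjoint (T i) (u - v)) = 0.
    by rewrite -[RHS]r0 /row_op; apply: eq_bigr => i _; rewrite ffunE.
  by rewrite -Re_hdot_row rE hdot0l.
move/eqP; rewrite psumr_eq0 => [/allP h|i _]; last exact: sqr_ge0.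
apply/ffunP => i; have := h i (mem_index_enum _).
by rewrite sqrf_eq0 rnorm_eq0 !ffunE => /eqP.
Qed.

(* If [T^*T] were not onto [Im T^*], the junk value 0 of [inv_TstarT] would make
   the right-hand side of the identity vanish on all of [Im T^*], because the
   complement of a proper subspace spans. *)
Lemma operator_identity_adjoint m : operator_identity m T ->
  forall x i, adjoint (T i) (sigma T (delta m) x) = adjoint (T i) x.
Proof.
move=> opid.
pose V := range (row_adj T); pose S := row_adj T \o row_op T.
pose B (v : {ffun 'I_n -> H}) : {ffun 'I_n -> H} := [ffun i => delta m (v i)].
have BV v : V v -> inv_TstarT T v = B v by exact: opid.
have BD u v : B (u + v) = B u + B v by apply/ffunP => i; rewrite !ffunE linearD.
have SB u v : S (u - v) = S u - S v by rewrite /S /= row_opB row_adjB.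
have VB u v : V u -> V v -> V (u - v).
  by move=> [x _ <-] [y _ <-]; exists (x - y); rewrite ?row_adjB.
have SV v : V v -> V (S v) by exists (row_op T v).
pose V0 := S @` V.
have pinvS u : V u -> inv_TstarT T (S u) = u.
  by move=> [x _ <-]; exact: inv_TstarTK.
have pinv0 v : ~ V0 v -> inv_TstarT T v = 0.
  move=> nV0; rewrite /inv_TstarT /pinv_ splitV.
  pose fS : set_surj V (S @` V) S := fun _ => id.
  by rewrite -[X in odflt _ X]/('oinv_fS v) oinv_surj; case: pselect.
have VV0 v : V v -> V0 v.
  move=> Vv; apply: contrapT => nV0.
  have Bv : B v = 0 by rewrite -BV// pinv0.
  have BS : B (S v) = 0.
    have nV : ~ V0 (v + S v).
      move=> [u Vu uE]; apply: nV0; exists (u - v); first exact: VB.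
      by rewrite SB uE addrK.
    have : B (v + S v) = 0.
      rewrite -BV ?pinv0// -[S v]opprK; apply: (VB) => //.
      rewrite -sub0r; apply: (VB); last exact: SV.
      by exists 0 => //; apply/ffunP => i; rewrite !ffunE linear0.
    by rewrite BD Bv add0r.
  (* Now [v = inv_TstarT T (S v) = B (S v) = 0], and 0 is its own image under [S], against [nV0]. *)
  apply: nV0; exists v => //.
  have := pinvS v Vv; rewrite BV ?BS; [move=> <-|exact: SV].
  by rewrite (_ : S 0 = 0)// -[X in S X](subrr 0) SB subrr.
move=> x i.
have [u Vu uE] := VV0 _ (ex_intro2 _ _ x I erefl : V (row_adj T x)).
have := pinvS u Vu; rewrite uE BV; last by exists x.
move=> Bu; move/ffunP : uE => /(_ i); rewrite !ffunE => <-; congr (adjoint _ _).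
rewrite /row_op -Bu; apply: eq_bigr => j _; by rewrite !ffunE.
Qed.

Hypothesis Tcontr : row_contraction T.

Lemma row_op_le (h : 'I_n -> H) :
  rnorm (\sum_i T i (h i)) ^+ 2 <= \sum_i rnorm (h i) ^+ 2.
Proof.
have := Tcontr [ffun i => h i]; rewrite /row_op /row_norm.
under eq_bigr do rewrite ffunE.
under [X in sqrtC X]eq_bigr do rewrite ffunE rnormE -rmorphXn.
rewrite -rmorph_sum rnormE.
have s0 : 0 <= \sum_i rnorm (h i) ^+ 2 by rewrite sumr_ge0// => i _; exact: sqr_ge0.
rewrite -{1}(sqr_sqrtr s0) rmorphXn /= sqrCK ?ler0c ?sqrtr_ge0// lecR => hle.
by rewrite -[leRHS](sqr_sqrtr s0) ler_pXn2r ?nnegrE ?rnorm_ge0 ?sqrtr_ge0.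
Qed.

(** With [s] the left side, [s = Re <TT^*x, x> <= |TT^*x| |x| <= sqrt(s) |x|]. *)
Lemma row_adj_le x : \sum_i rnorm (adjoint (T i) x) ^+ 2 <= rnorm x ^+ 2.
Proof.
set s := \sum_i _.
have s0 : 0 <= s by rewrite sumr_ge0// => i _; exact: sqr_ge0.
have sE : s = Re (hdot (\sum_i T i (adjoint (T i) x)) x).
  by rewrite Re_hdot_row.
have h1 := row_op_le (fun i => adjoint (T i) x).
have h2 : s <= rnorm (\sum_i T i (adjoint (T i) x)) * rnorm x.
  by rewrite sE cauchy_schwarz_re.
move: h1 h2; rewrite -/s; move: (rnorm_ge0 (\sum_i T i (adjoint (T i) x))) (rnorm_ge0 x).
move: (rnorm _) (rnorm _) => q p p0 q0 h1 h2.
rewrite leNgt; apply/negP => sp.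
have s1 : 0 < s by rewrite (le_lt_trans (sqr_ge0 q)).
have : s ^+ 2 <= p ^+ 2 * q ^+ 2.
  by rewrite -exprMn mulrC ler_pXn2r ?nnegrE ?mulr_ge0// mulrC.
by rewrite expr2; nra.
Qed.

Lemma adjoint_le i x : rnorm (adjoint (T i) x) <= rnorm x.
Proof.
rewrite -(@ler_pXn2r _ 2)// ?nnegrE ?rnorm_ge0// (le_trans _ (row_adj_le x))//.
by rewrite (bigD1 i)//= lerDl sumr_ge0// => j _; exact: sqr_ge0.
Qed.

(** [X] is enclosed between two contractions, the row operator and its adjoint. The constant does
    not grow, so all iterates of [sigma] share one bound. *)
Lemma sigma_le X (K : R) : 0 <= K -> (forall x, rnorm (X x) <= K * rnorm x) ->
  forall x, rnorm (sigma T X x) <= K * rnorm x.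
Proof.
move=> K0 XK x; rewrite -(@ler_pXn2r _ 2)// ?nnegrE ?mulr_ge0 ?rnorm_ge0//.
rewrite (le_trans (row_op_le _))// exprMn (le_trans _ (ler_wpM2l (sqr_ge0 K) (row_adj_le x)))//.
rewrite mulr_sumr ler_sum// => i _.
by rewrite -exprMn ler_pXn2r ?nnegrE ?mulr_ge0 ?rnorm_ge0.
Qed.

Lemma iter_sigma_le X (K : R) : 0 <= K -> (forall x, rnorm (X x) <= K * rnorm x) ->
  forall j x, rnorm (iter j (sigma T) X x) <= K * rnorm x.
Proof. by move=> K0 XK; elim=> //= j IH; exact: sigma_le. Qed.

Lemma iter_sigma_id_le j x : rnorm (iter j (sigma T) idfun x) <= rnorm x.
Proof.
have := @iter_sigma_le idfun 1 ler01 _ j x; rewrite mul1r; apply.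
by move=> y; rewrite mul1r.
Qed.

Lemma defect_bound l : exists2 K, 0 <= K & forall x, rnorm (defect l x) <= K * rnorm x.
Proof.
elim: l => [|l [K K0 hK]]; first by exists 1 => // x; rewrite mul1r.
exists (K + K) => [|x /=]; first exact: addr_ge0.
rewrite (le_trans (rnormD _ _))// rnormN mulrDl lerD//.
exact: sigma_le.
Qed.

Lemma delta_bound m : exists2 K, 0 <= K & forall x, rnorm (delta m x) <= K * rnorm x.
Proof.
exists (\sum_(j < m) Re `|(-1) ^+ j * 'C(m, j.+1)%:R : C|) => [|x].
  by rewrite sumr_ge0// => j _; exact: Re_norm_ge0.
rewrite (le_trans (rnorm_sum _ _ _))// mulr_suml ler_sum// => j _.
by rewrite rnormZ ler_wpM2l ?Re_norm_ge0// iter_sigma_id_le.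
Qed.

End RowContractions.

(** * Powers of a commuting tuple *)

Section MultiPowers.
Variables (n : nat) (X : Type) (f : 'I_n -> X -> X).
Local Notation mi := (multiindex n).

(** The factors come in the fixed order of [enum]. Plain functions are allowed so that the
    definition serves a tuple and its adjoints alike. *)
Definition mpow (a : mi) (x : X) : X :=
  foldr (fun i y => iter (a i) (f i) y) x (enum 'I_n).

Lemma mpow0 x : mpow (mzero n) x = x.
Proof. by rewrite /mpow; elim: (enum _) => //= i s ->; rewrite ffunE. Qed.

Hypothesis fC : forall i j x, f i (f j x) = f j (f i x).

Lemma mpow_eadd i a x : mpow (eadd i a) x = f i (mpow a x).
Proof.
have itC j k l y : iter k (f j) (f l y) = f l (iter k (f j) y).
  by elim: k => //= k ->; rewrite fC.
rewrite /mpow; have : uniq (enum 'I_n) by exact: enum_uniq.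
have : i \in enum 'I_n by rewrite mem_enum.
elim: (enum _) => //= j s IH; rewrite inE => /orP[/eqP <-|si] /andP[js us].
  rewrite ffunE eqxx addn1 /=; congr (f i (iter _ _ _)).
  elim: s js {IH us} => //= k s IH; rewrite inE negb_or => /andP[ik /IH ->].
  by rewrite ffunE eq_sym (negPf ik) addn0.
rewrite IH// ffunE; have [ji|_] := eqVneq j i; first by rewrite ji si in js.
by rewrite addn0 itC.
Qed.

Lemma mpow_f i a x : mpow a (f i x) = f i (mpow a x).
Proof.
elim/mi_ind: a => [|j a IH]; first by rewrite !mpow0.
by rewrite !mpow_eadd IH fC.
Qed.

End MultiPowers.

(** * Neumann iteration *)

Section Resolvent.
Variables (R : realType) (H : hilbertType R[i]).

(** Iteration of [y |-> x + t G y], a contraction of ratio 1/2, so [y] is [(1 - t G)^-1 x]. The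
    bound is uniform in [t], as the remainder estimate in [iter_sym_T] requires. *)
Lemma resolvent (G : {linear H -> H}) (M t : R) :
  0 <= t -> t * M <= 2^-1 -> 0 <= M -> (forall x, rnorm (G x) <= M * rnorm x) ->
  forall x, exists2 y, y = x + t%:C%C *: G y & rnorm y <= 2 * rnorm x.
Proof.
move=> t0 tM M0 GM x.
have tG u : rnorm (t%:C%C *: G u) <= rnorm u / 2.
  rewrite rnormZr// (le_trans (ler_wpM2l t0 (GM u)))// mulrA [leRHS]mulrC.
  by rewrite ler_wpM2r ?rnorm_ge0.
pose u := fix u k := if k is k'.+1 then x + t%:C%C *: G (u k') else x.
have ub k : rnorm (u k) <= 2 * rnorm x.
  elim: k => [|k IH] /=; first by have := rnorm_ge0 x; lra.
  rewrite (le_trans (rnormD _ _))//; have := tG (u k); lra.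
have uc N j k : rnorm (u (N + j)%N - u (N + k)%N) <= (4 * rnorm x) * (2^-1) ^+ N.
  elim: N => [|N IH].
    rewrite expr0 mulr1 (le_trans (rnormB_tri 0 _ _))// !subr0.
    have := ub j; have := ub k; rewrite !add0n; lra.
  rewrite !addSn /= opprD addrACA subrr add0r -scalerBr -linearB (le_trans (tG _))// exprSr mulrA.
  by rewrite ler_wpM2r// invr_ge0.
have [e e0|l lP] := @rnorm_cauchy_cvg _ _ _ (\oo : set_system nat) _ u.
  have K0 : 0 < 4 * rnorm x + 1 by have := rnorm_ge0 x; lra.
  have [N hN] : exists N, (2^-1 : R) ^+ N <= e / (4 * rnorm x + 1).
    have : (fun k => (2^-1 : R) ^+ k) @ \oo --> (0 : R).
      by apply: cvg_expr; rewrite ger0_norm ?invf_lt1// ltr1n.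
    move/cvgrPdist_le => /(_ _ (divr_gt0 e0 K0)) h.
    have [N hN] := filter_ex h; exists N; move: hN.
    by rewrite sub0r normrN ger0_norm// exprn_ge0.
  exists [set k | (N <= k)%N]; first by exists N.
  move=> j k /= /subnKC <- /subnKC <-; rewrite (le_trans (uc _ _ _))//.
  move: hN; rewrite ler_pdivlMr//; have := exprn_ge0 N (ltac:(by []) : 0 <= 2^-1 :> R).
  have := rnorm_ge0 x; move: (_ ^+ N) (rnorm x) => p q; nra.
exists l; last first.
  apply/ler_addgt0Pr => e e0; have [k kl] := filter_ex (lP e e0).
  rewrite -[l](subrK (u k)) (le_trans (rnormD _ _))// addrC lerD//.
  by rewrite rnorm_distC.
apply/eqP; rewrite -subr_eq0; apply/eqP/rnorm_eps => e e0.
have e2 : 0 < e / 2 by rewrite divr_gt0.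
have F1 := lP _ e2.
have [N _ hN] := F1.
have h1 : rnorm (u N.+1 - l) <= e / 2 by apply: hN => /=.
have h2 : rnorm (u N - l) <= e / 2 by apply: hN => /=.
rewrite (le_trans (rnormB_tri (u N.+1) _ _))// rnorm_distC.
have : rnorm (x + t%:C%C *: G l - u N.+1) <= e / 2 / 2.
  rewrite /= opprD addrACA subrr add0r -scalerBr -linearB (le_trans (tG _))//.
  by rewrite rnorm_distC ler_wpM2r// invr_ge0.
lra.
Qed.

End Resolvent.

(** * Regularity at the origin *)

Section Regular.
Variables (R : realType) (n m : nat).
Local Notation C := R[i].
Variables (H : hilbertType C) (T : 'I_n -> bounded_operator H).
Hypotheses (Tcomm : commuting T) (Tcontr : row_contraction T).
Hypothesis Treg : regular_at0 T.
Hypothesis Tid : forall x i, adjoint (T i) (sigma T (delta T m) x) = adjoint (T i) x.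
Implicit Types (x y : H).
Local Notation P := (defect T m).
Local Notation F w := (fun a => mpow (fun i => T i : H -> H) a w).

Definition in_W w := forall i, adjoint (T i) w = 0.

Lemma defect_in_W x : in_W (P x).
Proof. by move=> i; rewrite defect_delta (linearB (adjoint (T i))) /= Tid subrr. Qed.

Lemma defect_T i x : P (T i x) = 0.
Proof.
apply: hdot_ext => y.
by rewrite hdot0l defect_selfadjoint adjointP defect_in_W hdot0r.
Qed.

Lemma hdot_defect_W x w : in_W w -> hdot (P x) w = hdot x w.
Proof. by move=> Ww; rewrite defect_selfadjoint defect_wandering. Qed.

(** The operator [G(z)] with [s] for [z]; the small parameter [t] is kept apart. *)
Definition sym (s : 'I_n -> C) x := \sum_i s i *: delta T m (adjoint (T i) x).

Lemma sym_is_linear s : linear (sym s).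
Proof.
move=> a x y; rewrite /sym scaler_sumr -big_split; apply: eq_bigr => i _ /=.
by rewrite (linearP (adjoint (T i))) (linearP (delta T m)) /= scalerDr !scalerA mulrC.
Qed.
HB.instance Definition _ s := GRing.isLinear.Build C H H _ (sym s) (sym_is_linear s).

Lemma sym_bound s : exists2 M, 0 <= M & forall x, rnorm (sym s x) <= M * rnorm x.
Proof.
have [K K0 hK] := delta_bound Tcontr m.
exists (\sum_i Re `|s i| * K) => [|x].
  by rewrite sumr_ge0// => i _; rewrite mulr_ge0 ?Re_norm_ge0.
rewrite (le_trans (rnorm_sum _ _ _))// mulr_suml ler_sum// => i _.
rewrite rnormZ -mulrA ler_wpM2l ?Re_norm_ge0// (le_trans (hK _))// ler_wpM2l//.
exact: adjoint_le.
Qed.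

(* [(T_i - t s_i) x] lies in the range of [T - t s]; writing it as
   [(1 - t sym s) y], the wandering part of [y] lies in that range as well, hence
   vanishes by regularity. *)
Lemma regular_resolvent (s : 'I_n -> C) : exists2 d : R, 0 < d & forall t : R, 0 < t < d ->
  forall y x i w, in_W w ->
    y = (T i x - (t%:C%C * s i) *: x) + t%:C%C *: sym s y -> hdot y w = 0.
Proof.
case: Treg => _ [eps eps0 hreg].
have := eps0; rewrite ltcE => /andP[/eqP /= ie0 re0].
have eE : eps = (Re eps)%:C%C by rewrite -[LHS]RRe_real// gtr0_real.
pose S := \sum_i Re `|s i| ^+ 2.
have S0 : 0 <= S by rewrite sumr_ge0// => i _; exact: sqr_ge0.
exists (Re eps / (S + 1)) => [|t /andP[t0 td]]; first by rewrite divr_gt0// ltr_wpDl.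
move=> y x i w Ww yE.
pose z : 'rV[C]_n := \row_j (t%:C%C * s j).
have zeps : euclid_norm z < eps.
  rewrite eE euclid_norm_lt//.
  apply: (@le_lt_trans _ _ (t ^+ 2 * S)).
    rewrite mulr_sumr ler_sum// => j _; rewrite mxE normrM.
    by rewrite -[ `|s j|]RRe_real ?normr_real// ger0_norm ?ler0c ?(ltW t0)// -rmorphM exprMn.
  have tS : t * (S + 1) < Re eps by rewrite -ltr_pdivlMr// ltr_wpDl.
  have tS2 : (t * (S + 1)) ^+ 2 < Re eps ^+ 2.
    by rewrite ltr_pXn2r ?nnegrE ?mulr_ge0 ?(ltW t0) ?(ltW re0) ?addr_ge0.
  apply: le_lt_trans tS2; rewrite exprMn ler_wpM2l ?sqr_ge0//; nra.
have [_ [_ dsum]] := hreg z zeps.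
have Py : P y = 0.
  have : [set 0] (P y).
    rewrite -dsum; split; last by apply/wanderingP; exact: defect_in_W.
    (* On this family [T - Z] takes the value [T_i x - t s_i x + t sym s y - sigma(delta) y], which
       is [y - sigma(delta) y = P y]. *)
    exists [ffun j => (if j == i then x else 0) - delta T m (adjoint (T j) y)] => //.
    rewrite /row_op /row_scalar.
    under eq_bigr do rewrite ffunE linearB.
    under [X in _ - X]eq_bigr do rewrite ffunE mxE scalerBr -[X in _ - X]scalerA.
    rewrite !sumrB -scaler_sumr -/(sym s y).
    have -> : \sum_j T j (if j == i then x else 0) = T i x.
      by rewrite (bigD1 i)//= eqxx big1 ?addr0// => j /negPf->; rewrite linear0.
    have -> : \sum_j (t%:C%C * s j) *: (if j == i then x else 0) = (t%:C%C * s i) *: x.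
      by rewrite (bigD1 i)//= eqxx big1 ?addr0// => j /negPf->; rewrite scaler0.
    rewrite defect_delta -[\sum_j T j _]/(sigma T (delta T m) y).
    move: yE; set S' := sigma _ _ _; set u := _ *: sym s y => yE.
    by rewrite opprB [in RHS]yE -!addrA; congr (_ + _); rewrite addrC -addrA addrCA.
  by [].
by rewrite -(hdot_defect_W y Ww) Py hdot0l.
Qed.

(** Coefficient of [t^k] in [<(1 - t G)^-1 (T_i - t s_i) x, w> = 0], where [G] is [sym s]. *)
Lemma iter_sym_T s w i x k : in_W w ->
  hdot (iter k (sym s) (T i x)) w =
  if k is k'.+1 then s i * hdot (iter k' (sym s) x) w else 0.
Proof.
move=> Ww; have [d d0 hd] := regular_resolvent s.
have [M M0 hM] := sym_bound s.
pose b k := if k is k'.+1 then s i * hdot (iter k' (sym s) x) w else 0.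
pose a k : C^o := hdot (iter k (sym s) (T i x)) w - b k.
have itD j u v : iter j (sym s) (u + v) = iter j (sym s) u + iter j (sym s) v.
  by elim: j => //= j ->; rewrite linearD.
have itZ j (c : C) v : iter j (sym s) (c *: v) = c *: iter j (sym s) v.
  by elim: j => //= j ->; rewrite linearZ.
have itM j v : rnorm (iter j (sym s) v) <= M ^+ j * rnorm v.
  elim: j => [|j IH] /=; first by rewrite mul1r.
  by rewrite (le_trans (hM _))// exprS -mulrA ler_wpM2l.
suff a0 : a k = 0 by apply/eqP; rewrite -subr_eq0; apply/eqP.
pose r := 2 * (rnorm (T i x) + Re `|s i| * rnorm x).
pose K := Re `|b k.+1| + M ^+ k.+1 * r * rnorm w.
have M1 : 0 < 2 * (M + 1) by lra.
apply: (@small_coefs0 _ _ k.+1 a K (Order.min (Order.min d 1) (2 * (M + 1))^-1)) => //.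
  by rewrite !lt_min d0 ltr01 invr_gt0.
move=> t /andP[t0]; rewrite !lt_min => /andP[/andP[td t1] tM].
have tM2 : t * M <= 2^-1.
  have : t * (2 * (M + 1)) < 1 by rewrite -ltr_pdivlMr ?div1r.
  rewrite -[2^-1]div1r; lra.
have [y yE yle] := resolvent (ltW t0) tM2 M0 hM (T i x - (t%:C%C * s i) *: x).
have yw : hdot y w = 0 by apply: (hd t _ y x i w Ww yE); rewrite t0.
(* Exact remainder after [N] terms: [t^N] times a factor bounded independently of [t] because
   [|y| <= r], as [small_coefs0] demands. *)
have sumE N : \sum_(j < N) t%:C%C ^+ j *: a j = t%:C%C ^+ N * (b N - hdot (iter N (sym s) y) w).
  elim: N => [|N IH]; first by rewrite big_ord0 yw subr0 mulr0.
  rewrite big_ord_recr /= IH [X in _ + X]/(_ * _) -mulrDr exprSr -mulrA; congr (_ * _).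
  rewrite [in LHS]yE !itD !itZ -scaleNr itZ !hdotDl !hdotZl -iterSr /a.
  rewrite /b; ring.
have ry : rnorm y <= r.
  rewrite (le_trans yle)// /r ler_pM2l// (le_trans (rnormD _ _))// lerD2l rnormN rnormZ.
  rewrite ler_wpM2r ?rnorm_ge0// normrM ger0_norm ?ler0c ?(ltW t0)// Re_realM.
  by rewrite ler_piMl ?Re_norm_ge0 ?ltW.
rewrite sumE -[X in rnorm X]/(_ *: (_ : C^o)) -rmorphXn rnormZr ?exprn_ge0 ?(ltW t0)// mulrC.
rewrite ler_wpM2r ?exprn_ge0 ?(ltW t0)// (le_trans (rnormB_tri 0 _ _))// !subr0 lerD//.
rewrite /rnorm (le_trans (cauchy_schwarz _ _))// ler_wpM2r ?rnorm_ge0//.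
by rewrite (le_trans (itM _ _))// ler_wpM2l ?exprn_ge0.
Qed.

(** The adjoint of [sym] at the conjugate scalars. It is linear in [s], so the identities below are
    polynomial in [s] itself. *)
Definition sym_adj (s : 'I_n -> C) x := \sum_i s i *: T i (delta T m x).

Lemma hdot_iter_sym s k x w :
  hdot (iter k (sym s) x) w = hdot x (iter k (sym_adj (fun i => (s i)^*)) w).
Proof.
elim: k x => // k IH x; rewrite iterSr IH iterS.
rewrite /sym /sym_adj hdot_suml hdot_sumr; apply: eq_bigr => i _.
by rewrite hdotZl hdotZr conjCK delta_selfadjoint -adjointPr.
Qed.

Lemma adjoint_iter_sym_adj s w i k : in_W w ->
  adjoint (T i) (iter k.+1 (sym_adj s) w) = s i *: iter k (sym_adj s) w.
Proof.
move=> Ww; pose z i := (s i)^*.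
have sE : s = fun i => (z i)^* by apply/funext => j; rewrite conjCK.
apply: hdot_ext => x; rewrite hdotC [RHS]hdotC; congr (_^*).
rewrite -adjointP hdotZr sE -hdot_iter_sym (iter_sym_T _ _ _ k.+1)//.
by rewrite -hdot_iter_sym conjCK.
Qed.

Definition lincomb (s : 'I_n -> C) x := \sum_i s i *: T i x.

(* The coefficients of [(1 - lambda)^-m], where [lambda] is [lincomb s]. *)
Lemma iter_sym_adjE s w k : in_W w ->
  iter k (sym_adj s) w = (nbin m k)%:R *: iter k (lincomb s) w.
Proof.
move=> Ww; pose E k := iter k (sym_adj s) w.
have lZ (a : C) x : lincomb s (a *: x) = a *: lincomb s x.
  by rewrite /lincomb scaler_sumr; apply: eq_bigr => i _; rewrite linearZ !scalerA mulrC.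
have uS l j : defect T l.+1 (E j.+1) = defect T l (E j.+1) - lincomb s (defect T l (E j)).
  rewrite /= /sigma; congr (_ - _); apply: eq_bigr => i _.
  by rewrite adjoint_iter_sym_adj// !linearZ.
(* Induction upwards from [defect T m], which kills every [E j] with [j > 0] since these lie in the
   range of the row operator. Lowering the exponent by one means solving [uS] for the smaller
   defect, and this recursion is Pascal's rule [nbinS]. *)
suff h l j : (l <= m)%N -> defect T (m - l) (E j) = (nbin l j)%:R *: iter j (lincomb s) w.
  by have := h m k (leqnn m); rewrite subnn.
elim: l j => [|l IHl] j lm.
  rewrite subn0; case: j => [|j]; first by rewrite nbin0 scale1r defect_wandering.
  rewrite nbin0S scale0r /E iterS /sym_adj linear_sum big1// => i _.
  by rewrite linearZ /= defect_T scaler0.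
elim: j => [|j IHj]; first by rewrite nbin0 scale1r defect_wandering.
have := uS (m - l.+1)%N j; rewrite -subSn// subSS IHl ?(ltnW lm)// IHj lZ => e.
by rewrite nbinS natrD scalerDl e iterS subrK.
Qed.

Lemma iter_sym_adj_sum (m_gt0 : (0 < m)%N) (z : 'rV[C]_n) w k : in_W w ->
  iter k (sym_adj (z 0)) w =
  \sum_(a <- mdeg n k) monomial z a *: ((rho R m a)%:C%C *: F w a).
Proof.
move=> Ww; rewrite iter_sym_adjE//.
have TF i a : T i (F w a) = F w (eadd i a) by rewrite mpow_eadd.
have := iter_linear_comb (z 0) k TF; rewrite mpow0 => ->.
rewrite scalerA scaler_sumr big_seq [RHS]big_seq; apply: eq_bigr => a.
rewrite in_mdeg => /eqP ak; rewrite !scalerA; congr (_ *: _).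
rewrite rhoE// ak fmorph_div rmorphM !rmorph_nat /monomial; ring.
Qed.

(** Coefficient of [z^b] in the relation [adjoint_iter_sym_adj], both sides of which are homogeneous
    polynomials of degree [k+1] in [z] once expanded by [iter_sym_adj_sum]. *)
Lemma adjoint_mpow (m_gt0 : (0 < m)%N) w i b : in_W w ->
  (rho R m b)%:C%C *: adjoint (T i) (F w b) =
  if b i is 0%N then 0 else (rho R m (esub i b))%:C%C *: F w (esub i b).
Proof.
move=> Ww; have [b0|b0] := posnP (deg b).
  by rewrite (deg_eq0 b0) ffunE mpow0 Ww scaler0.
case bk : (deg b) b0 => [//|k] _.
pose g (a : multiindex n) : H := (rho R m a)%:C%C *: F w a.
pose c (a : multiindex n) : H :=
  (rho R m a)%:C%C *: adjoint (T i) (F w a) - (if a i is 0%N then 0 else g (esub i a)).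
suff : c b = 0 by move/eqP; rewrite subr_eq0 => /eqP.
apply: (@monomial_coefs0 R n H k.+1 c 1 ltr01 _ b bk) => z _.
under eq_bigr do rewrite scalerBr.
rewrite sumrB; apply/eqP; rewrite subr_eq0; apply/eqP.
have := adjoint_iter_sym_adj (z 0) i k Ww; rewrite !iter_sym_adj_sum// linear_sum => e.
transitivity (z 0 i *: \sum_(a <- mdeg n k) monomial z a *: g a).
  rewrite -e; apply: eq_bigr => a _; rewrite [RHS]linearZ; congr (_ *: _).
  by rewrite linearZ.
rewrite [RHS](bigID (fun a : multiindex n => 0 < a i)%N) /= [X in _ + X]big1 ?addr0; last first.
  by move=> a; case: (a i) => //; rewrite scaler0.
rewrite big_mdeg_eadd scaler_sumr; apply: eq_bigr => a _.
rewrite scalerA -monomial_eadd eaddK; have := eadd_gt0 i a.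
by case: (eadd i a i).
Qed.

End Regular.

(** * Restriction to invariant and reducing subspaces *)

Section OrthoRestriction.
Variables (R : realType) (H : hilbertType R[i]) (S : set H) (A : bounded_operator H).
Hypothesis AS : forall x, x \in ortho_pred S -> A x \in ortho_pred S.

Definition ortho_restr (x : ortho S) : ortho S := Ortho (AS (orthoP x)).

Lemma ortho_restr_linear : linear ortho_restr.
Proof. by move=> a x y; apply: val_inj; rewrite /= linearP. Qed.
HB.instance Definition _ :=
  GRing.isLinear.Build R[i] (ortho S) (ortho S) _ ortho_restr ortho_restr_linear.

Lemma ortho_restriction :
  exists A' : bounded_operator (ortho S), forall x, val (A' x) = A (val x).
Proof.
have [M _ hM] := bounded_operator_bound A.
by exists (@mk_bounded _ _ (ortho_restr : {linear _ -> _}) M (fun x => hM (val x))).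
Qed.

End OrthoRestriction.

Lemma ortho_restriction_adjoint (R : realType) (H : hilbertType R[i]) (S : set H)
    (A : bounded_operator H) (A' : bounded_operator (ortho S)) :
  (forall x, x \in ortho_pred S -> adjoint A x \in ortho_pred S) ->
  (forall x, val (A' x) = A (val x)) ->
  forall x, val (adjoint A' x) = adjoint A (val x).
Proof.
move=> AS A'E x; rewrite (@adjoint_eq _ _ A' x (Ortho (AS _ (orthoP x))))//.
by move=> y; rewrite !ortho_hdot A'E adjointP.
Qed.

(** * The Bergman part of a tuple *)

Section BergmanModel.
Variables (R : realType) (n m : nat).
Local Notation C := R[i].
Local Notation mi := (multiindex n).
Variables (H : hilbertType C) (T : 'I_n -> bounded_operator H).
Hypotheses (m_gt0 : (0 < m)%N) (Tcomm : commuting T) (Tcontr : row_contraction T).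
Local Notation P := (defect T m).
Local Notation W := (ortho_pred (range (row_op T))).
Local Notation F w := (fun a => mpow (fun i => T i : H -> H) a w).
Implicit Types (x y w : H) (a b : mi) (B : {fset mi}).

Lemma in_WP w : reflect (in_W T w) (w \in W).
Proof.
apply: (iffP (ortho_predP _ _)) => [h|/wanderingP h v vT]; first exact/wanderingP.
exact: h.
Qed.

Hypothesis PW : forall x, P x \in W.
Hypothesis adjF : forall w i b, w \in W ->
  (rho R m b)%:C%C *: adjoint (T i) (F w b) =
  if b i is 0%N then 0 else (rho R m (esub i b))%:C%C *: F w (esub i b).

Let rho_neq0 a : (rho R m a)%:C%C != 0 :> C.
Proof. by rewrite fmorph_eq0 gt_eqF// rho_gt0. Qed.

Let conjR (r : R) : (r%:C%C)^* = r%:C%C :> C.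
Proof. exact: conjc_real. Qed.

Lemma hdot_P x w : w \in W -> hdot (P x) w = hdot x w.
Proof. by move=> /in_WP Ww; rewrite defect_selfadjoint defect_wandering. Qed.

Lemma W_ext x y : x \in W -> y \in W -> (forall w, w \in W -> hdot x w = hdot y w) -> x = y.
Proof.
move=> xW yW h; apply/eqP; rewrite -subr_eq0; apply/eqP/hdotxx_eq0.
by rewrite hdotBl h ?subrr// rpredB.
Qed.

Lemma F_eadd w i a : F w (eadd i a) = T i (F w a).
Proof. exact: mpow_eadd. Qed.

(** Induction on [b]: a factor [T_i] of [F w' b] moves across as [T_i^*], where [adjF] lowers [a];
    once [b] is exhausted, any factor left in [F w a] is killed by [w']. So the [T^a w] have the
    orthogonality and norms of monomials in [H_m]. *)
Lemma hdot_F w w' a b : w \in W -> w' \in W ->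
  (rho R m a)%:C%C * hdot (F w a) (F w' b) = if a == b then hdot w w' else 0.
Proof.
move=> Ww Ww'; elim/mi_ind: b a => [|i b IH] a.
  rewrite mpow0; have [a0|/deg_gt0[i ai]] := posnP (deg a).
    by rewrite (deg_eq0 a0) eqxx mpow0 rho0// mul1r.
  rewrite -[in F w a](esubK ai) F_eadd adjointP (in_WP _ Ww') hdot0r mulr0.
  by case: eqP => // a0; move: ai; rewrite a0 ffunE.
rewrite F_eadd adjointPr -hdotZl adjF//.
case ai : (a i) => [|k].
  rewrite hdot0l; case: eqP => // ab; move: ai; rewrite ab.
  by have := eadd_gt0 i b; case: (eadd i b i).
have ai0 : (0 < a i)%N by rewrite ai.
by rewrite hdotZl IH -(inj_eq (@eadd_inj _ i)) esubK.
Qed.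

(** The [a]-th Taylor coefficient of the function that will represent [x]; [coef_hdot] characterizes
    it inside [W]. *)
Definition coef x a : H :=
  (rho R m a)%:C%C *: P (mpow (fun i => adjoint (T i) : H -> H) a x).

Lemma coef_W x a : coef x a \in W.
Proof. by rewrite rpredZ// PW. Qed.

Lemma coef_hdot x a w : w \in W ->
  hdot (coef x a) w = (rho R m a)%:C%C * hdot x (F w a).
Proof.
move=> Ww; rewrite hdotZl hdot_P//; congr (_ * _).
have aC := commuting_adjoint Tcomm.
elim/mi_ind: a x => [|i a IH] x; first by rewrite !mpow0.
rewrite (etrans (mpow_eadd aC i a x) (esym (mpow_f aC i a x))) IH.
by rewrite F_eadd adjointPr.
Qed.

Lemma coef_is_linear a : linear (coef ^~ a).
Proof.
move=> c x y; apply: W_ext; rewrite ?rpredD ?rpredZ ?coef_W//= => w Ww.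
rewrite coef_hdot// [RHS]hdotDl [X in _ = X + _]hdotZl !coef_hdot// hdotDl hdotZl; ring.
Qed.

Definition psum (c : mi -> H) B := \sum_(a <- B) F (c a) a.

Lemma hdot_psum (c : mi -> H) B w b : (forall a, c a \in W) -> w \in W ->
  (rho R m b)%:C%C * hdot (psum c B) (F w b) = if b \in B then hdot (c b) w else 0.
Proof.
move=> cW Ww; rewrite hdot_suml mulr_sumr.
have h a : (rho R m b)%:C%C * hdot (F (c a) a) (F w b) = if a == b then hdot (c b) w else 0.
  have := hdot_F a b (cW a) Ww; have := hdot_F b a Ww (cW a).
  have [->|ab] := eqVneq a b; first by [].
  move=> _ /eqP; rewrite mulf_eq0 (negPf (rho_neq0 a)) /= => /eqP->.
  by rewrite mulr0.
under eq_bigr do rewrite h.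
rewrite -big_mkcond; case: ifPn => bB.
  rewrite big_mkcond (big_fsetD1 b)//= eqxx big_seq big1 ?addr0// => a.
  by rewrite !inE => /andP[/negPf->].
rewrite big_seq_cond big1// => a /andP[aB /eqP ab].
by rewrite -ab aB in bB.
Qed.

Lemma rnorm_psum (c : mi -> H) B : (forall a, c a \in W) ->
  rnorm (psum c B) ^+ 2 = \sum_(a <- B) rnorm (c a) ^+ 2 / rho R m a.
Proof.
move=> cW; apply: (@complexI R); rewrite -hdotxx {2}/psum hdot_sumr rmorph_sum.
rewrite big_seq [RHS]big_seq; apply: eq_bigr => a aB.
apply: (mulfI (rho_neq0 a)); rewrite hdot_psum// aB hdotxx -rmorphM mulrCA divff ?mulr1//.
by rewrite gt_eqF// rho_gt0.
Qed.

Lemma psum_coef_dist x B :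
  rnorm (x - psum (coef x) B) ^+ 2 =
  rnorm x ^+ 2 - \sum_(a <- B) rnorm (coef x a) ^+ 2 / rho R m a.
Proof.
rewrite rnormB_sq rnorm_psum; last by move=> a; exact: coef_W.
have -> : hdot x (psum (coef x) B) =
    (\sum_(a <- B) rnorm (coef x a) ^+ 2 / rho R m a)%:C%C.
  rewrite rmorph_sum /psum hdot_sumr; apply: eq_bigr => a _.
  apply: (mulfI (rho_neq0 a)); rewrite -coef_hdot ?coef_W// hdotxx -rmorphM mulrCA divff ?mulr1//.
  by rewrite gt_eqF// rho_gt0.
by rewrite /=; ring.
Qed.

Lemma bessel x B : \sum_(a <- B) rnorm (coef x a) ^+ 2 / rho R m a <= rnorm x ^+ 2.
Proof. by rewrite -subr_ge0 -psum_coef_dist sqr_ge0. Qed.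

(** Orthogonality turns summable weighted norms into Cauchy partial sums. Their pairing with [F w b]
    is constant once the index set contains [b], which determines the coefficients of the limit. *)
Lemma synthesis (c : mi -> H) M : (forall a, c a \in W) -> norm_summable m c M ->
  exists2 x, has_usum (fun a => F (c a) a) x & coef x = c.
Proof.
move=> cW cM.
have [e e0|x hx] := @has_usum_ex R mi H (fun a => F (c a) a).
  have [|A hA] := summable_tail _ cM (exprn_gt0 2 e0).
    by move=> a; rewrite divr_ge0 ?sqr_ge0 ?(ltW (rho_gt0 _ _ _)).
  exists A => B; rewrite -(@ler_pXn2r _ 2)// ?nnegrE ?rnorm_ge0 ?(ltW e0)//.
  by rewrite -/(psum c _) rnorm_psum.
exists x => //; apply/funext => b; apply: W_ext; rewrite ?coef_W// => w Ww.
rewrite coef_hdot//; apply/eqP; rewrite -subr_eq0; apply/eqP/hdot_eps => e e0.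
pose K := rho R m b * rnorm (F w b).
have K0 : 0 <= K by rewrite mulr_ge0 ?rnorm_ge0 ?(ltW (rho_gt0 _ _ _)).
have [A hA] := hx (e / (K + 1)) (divr_gt0 e0 (ltr_wpDl K0 ltr01)).
have := hA _ (fsubsetUl A [fset b]%fset); rewrite -/(psum c _).
have := @hdot_psum c (A `|` [fset b])%fset w b cW Ww.
rewrite in_fsetU in_fset1 eqxx orbT => <-.
rewrite -mulrBr -hdotBl => h.
have r0 := ltW (rho_gt0 R m_gt0 b).
rewrite normrM ger0_norm ?ler0c// Re_realM.
rewrite (le_trans (ler_wpM2l r0 (cauchy_schwarz _ _)))// mulrCA -/K.
rewrite (le_trans (ler_wpM2r K0 h))// mulrAC ler_pdivrMr ?ltr_wpDl//.
by rewrite ler_pM2l// lerDl.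
Qed.

Definition Fset : set H := [set x | exists w a, w \in W /\ x = F w a].
(** A set, so that its complement can be formed again: [ortho_pred Fset] carries the coisometric
    part, and [ortho_pred Fperp], the closed span of the [T^a w], carries the shift. *)
Definition Fperp : set H := [set x | x \in ortho_pred Fset].

Lemma FperpP x : reflect (forall w a, w \in W -> hdot x (F w a) = 0) (x \in ortho_pred Fset).
Proof.
apply: (iffP (ortho_predP _ _)) => [h w a Ww|h _ [w [a [Ww ->]]]]; last exact: h.
by apply: h; exists w, a.
Qed.

Lemma Fperp_adjoint i x : x \in ortho_pred Fset -> adjoint (T i) x \in ortho_pred Fset.
Proof.
move=> /FperpP h; apply/FperpP => w a Ww.
by rewrite -adjointPr -F_eadd h.
Qed.

Lemma Fperp_T i x : x \in ortho_pred Fset -> T i x \in ortho_pred Fset.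
Proof.
move=> /FperpP h; apply/FperpP => w a Ww; rewrite adjointP.
apply: (mulfI (rho_neq0 a)); rewrite mulr0 -[X in X * _]conjR -hdotZr adjF//.
by case: (a i) => [|_]; rewrite ?hdot0r// hdotZr h// mulr0.
Qed.

Lemma Fperp2_T i x : x \in ortho_pred Fperp -> T i x \in ortho_pred Fperp.
Proof.
move=> /ortho_predP h; apply/ortho_predP => y Fy.
by rewrite adjointP h//; exact: Fperp_adjoint.
Qed.

Lemma usum_Fperp2 (c : mi -> H) x : (forall a, c a \in W) ->
  has_usum (fun a => F (c a) a) x -> x \in ortho_pred Fperp.
Proof.
move=> cW hx; apply/ortho_predP => y /FperpP Fy; apply: hdot_eps => e e0.
have K0 := rnorm_ge0 y.
have [A hA] := hx (e / (rnorm y + 1)) (divr_gt0 e0 (ltr_wpDl K0 ltr01)).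
have h := hA _ (fsubset_refl A).
have -> : hdot x y = hdot (x - psum c A) y.
  rewrite hdotBl hdot_suml big1 ?subr0// => a _.
  by apply: hdot_eq0C; exact: Fy.
rewrite (le_trans (cauchy_schwarz _ _))//.
rewrite (le_trans (ler_wpM2r K0 h))// mulrAC ler_pdivrMr ?ltr_wpDl//.
by rewrite ler_pM2l// lerDl.
Qed.

Lemma coef_inj x : x \in ortho_pred Fperp -> coef x = (fun=> 0) -> x = 0.
Proof.
move=> /ortho_predP xF x0; apply: hdotxx_eq0; apply: xF; apply/FperpP => w a Ww.
apply: (mulfI (rho_neq0 a)); rewrite -coef_hdot// x0 hdot0l mulr0//.
Qed.

(** Bessel's inequality makes the expansion of [x] converge, and its limit has the same coefficients
    as [x], so the difference is orthogonal to every [T^a w]. *)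
Lemma analysis x : exists2 y, has_usum (fun a => F (coef x a) a) y &
  y \in ortho_pred Fperp /\ x - y \in ortho_pred Fset.
Proof.
have [y hy cy] := synthesis (coef_W x) (bessel x).
exists y => //; split; first by apply: (usum_Fperp2 _ hy); exact: coef_W.
apply/FperpP => w a Ww; apply: (mulfI (rho_neq0 a)).
by rewrite hdotBl mulrBr -!coef_hdot// cy subrr mulr0.
Qed.

Lemma coef_T i x : coef (T i x) = fun a => if a i is 0%N then 0 else coef x (esub i a).
Proof.
apply/funext => a; apply: W_ext; rewrite ?coef_W//.
  by case: (a i) => [|_]; rewrite ?rpred0 ?coef_W.
move=> w Ww; rewrite coef_hdot// adjointP -[X in X * _]conjR -hdotZr adjF//.
by case: (a i) => [|_]; rewrite ?hdot0r ?hdot0l// hdotZr conjR coef_hdot.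
Qed.

(* If [defect l.+2] vanishes on the reducing subspace, then [X := defect l.+1]
   satisfies [sigma X = X] there, so [N X] telescopes to a bounded operator. *)
Lemma defect_Fperp x : x \in ortho_pred Fset -> \sum_i T i (adjoint (T i) x) = x.
Proof.
have dP y : y \in ortho_pred Fset -> P y = 0.
  move=> /FperpP Fy; apply: hdotxx_eq0; rewrite hdot_P//.
  by have := Fy _ (mzero n) (PW y); rewrite mpow0.
have step l : (forall y, y \in ortho_pred Fset -> defect T l.+2 y = 0) ->
    forall y, y \in ortho_pred Fset -> defect T l.+1 y = 0.
  move=> h y Fy; have [K K0 hK] := defect_bound Tcontr l.
  have itX N z : z \in ortho_pred Fset -> iter N (sigma T) (defect T l.+1) z = defect T l.+1 z.
    elim: N z => // N IH z Fz; rewrite iterS.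
    transitivity (sigma T (defect T l.+1) z).
      by apply: eq_bigr => i _; rewrite IH//; exact: Fperp_adjoint.
    by apply/eqP; rewrite eq_sym -subr_eq0; apply/eqP; exact: h.
  have itS N z : iter N (sigma T) (defect T l.+1) z =
      iter N (sigma T) (defect T l) z - iter N.+1 (sigma T) (defect T l) z.
    elim: N z => // N IH z; rewrite iterS /sigma.
    under eq_bigr do rewrite IH linearB.
    by rewrite sumrB.
  have NX N : N%:R * rnorm (defect T l.+1 y) <= 2 * K * rnorm y.
    have -> : N%:R * rnorm (defect T l.+1 y) =
        rnorm (\sum_(k < N) iter k (sigma T) (defect T l.+1) y).
      under [in RHS]eq_bigr do rewrite itX//.
      rewrite sumr_const card_ord -(scaler_nat N (defect T l.+1 y)).
      by rewrite -(rmorph_nat (real_complex R)) rnormZr.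
    under eq_bigr do rewrite itS.
    rewrite (_ : \sum_(k < N) _ = defect T l y - iter N (sigma T) (defect T l) y); last first.
      elim: N => [|N IH]; first by rewrite big_ord0 subrr.
      by rewrite big_ord_recr /= IH addrA subrK.
    rewrite (le_trans (rnormB_tri 0 _ _))// !subr0 -mulrA mulr_natl mulr2n lerD//.
    exact: iter_sigma_le.
  apply/eqP; rewrite -rnorm_eq0 eq_le rnorm_ge0 andbT leNgt; apply/negP => X0.
  have := NX (Num.truncn (2 * K * rnorm y / rnorm (defect T l.+1 y))).+1.
  rewrite -ler_pdivlMr// leNgt => /negP; apply.
  by rewrite truncnS_gt.
move=> Fx; have d1 l : (0 < l)%N -> (forall y, y \in ortho_pred Fset -> defect T l y = 0) ->
    defect T 1 x = 0.
  case: l => // l _; elim: l => [|l IH] h; first exact: h.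
  by apply: IH; apply: step.
have := d1 m m_gt0 dP; rewrite /= /sigma => /eqP; rewrite subr_eq0 => /eqP {2}->.
by [].
Qed.

Lemma reducing_parts x : exists y z,
  [/\ y \in ortho_pred Fset, z \in ortho_pred Fperp & x = y + z].
Proof.
have [z _ [zF xz]] := analysis x; exists (x - z), z; split=> //.
by rewrite subrK.
Qed.

Lemma coef_expansion x : x \in ortho_pred Fperp -> has_usum (fun a => F (coef x a) a) x.
Proof.
move=> xF; have [y hy [yF /ortho_predP xy]] := analysis x.
rewrite [X in has_usum _ X](_ : x = y)//; apply/eqP; rewrite -subr_eq0; apply/eqP/coef_inj.
  by rewrite rpredB.
apply/funext => a; apply: W_ext; rewrite ?coef_W ?rpred0// => w Ww.
by rewrite coef_hdot// xy ?mulr0 ?hdot0l//; exists w, a.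
Qed.

Local Notation D := (ortho (range (row_op T))).

Definition coefD x a : D := Ortho (coef_W x a).

Lemma coefD_summable x : norm_summable m (coefD x) (rnorm x ^+ 2).
Proof. by move=> B; exact: bessel. Qed.

(** [U x] is the series with coefficients [coefD x]. Surjectivity is [synthesis], the norm is
    Parseval's equality, and [coef_T] matches the coefficients of multiplication by [z_i]. *)
Lemma bergman_unitary (T1 : 'I_n -> bounded_operator (ortho Fperp)) :
  (forall i (x : ortho Fperp), val (T1 i x) = T i (val x)) -> unitarily_equivalent_Mz D m T1.
Proof.
move=> T1E.
have [u uP] := choice (fun x : ortho Fperp =>
  norm_summable_series m_gt0 (coefD_summable (val x))).
have ulin : linear u.
  move=> c x y; apply/funext => z.
  have h v : has_usum (fun a => monomial (sval z) a *: coefD (val v) a) (u v z).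
    exact: (power_seriesP _ _).1 (uP v) z.
  apply: (has_usum_unique (h _)).
  have := has_usumP c (h x) (h y); apply: eq_has_usum => a.
  rewrite scalerA mulrC -scalerA -scalerDr; congr (_ *: _).
  apply: val_inj; rewrite [LHS]linearP.
  exact: esym (coef_is_linear a c (val x) (val y)).
have [U UE] := linear_pack ulin.
exists U; split.
- apply/seteqP; split=> [_ [x _ <-]|f /(HmP _ m_gt0)[c [M [fc cM]]]].
    rewrite UE; apply: (HmP _ m_gt0).2; exists (coefD (val x)), (rnorm (val x) ^+ 2).
    by split; [exact: uP|exact: coefD_summable].
  have cW a : val (c a) \in W by exact: orthoP.
  have [x hx cx] := synthesis cW (cM : norm_summable m (fun a => val (c a)) M).
  exists (Ortho (usum_Fperp2 cW hx)) => //; rewrite UE; apply/funext => z.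
  have h := (power_seriesP _ _).1 (uP (Ortho (usum_Fperp2 cW hx))) z.
  apply: (has_usum_unique h); have := (power_seriesP _ _).1 fc z.
  by apply: eq_has_usum => a; congr (_ *: _); apply: val_inj; rewrite /= cx.
- move=> x; rewrite UE; apply: (Hm_sqnorm_eq m_gt0 (uP x) (coefD_summable (val x))).
  (* As [d <= 1] and [d <= e], a distance of at most [d] has square at most [e]. *)
  move=> e e0; pose d := Order.min 1 e.
  have d0 : 0 < d by rewrite lt_min ltr01.
  have [A hA] := coef_expansion (orthoP x) d0.
  exists A; have := hA _ (fsubset_refl A); rewrite -/(psum (coef (val x)) A) => h.
  have : rnorm (val x - psum (coef (val x)) A) ^+ 2 <= e.
    apply: (@le_trans _ _ (d ^+ 2)).
      by rewrite ler_pXn2r ?nnegrE ?rnorm_ge0 ?(ltW d0).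
    rewrite expr2 (@le_trans _ _ (1 * d))// ?ler_wpM2r ?(ltW d0) ?ge_min ?lexx//.
    by rewrite mul1r ge_min lexx orbT.
  rewrite psum_coef_dist; lra.
- move=> i x; rewrite !UE; apply/funext => z.
  have h := (power_seriesP _ _).1 (uP (T1 i x)) z; apply: (has_usum_unique h).
  have := (power_seriesP _ _).1 (power_series_shift i (uP x)) z.
  apply: eq_has_usum => a; congr (_ *: _); apply: val_inj.
  by rewrite /= T1E coef_T /shift_coef; case: (a i).
Qed.

Theorem bergman_decomposition :
  exists (H0 H1 : hilbertType C)
         (T0 : 'I_n -> bounded_operator H0) (T1 : 'I_n -> bounded_operator H1),
    [/\ tuple_direct_sum T T0 T1, spherical_coisometry T0, commuting T1
      & exists D : hilbertType C, unitarily_equivalent_Mz D m T1].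
Proof.
have [T0 T0E] := choice (fun i => ortho_restriction (@Fperp_T i)).
have [T1 T1E] := choice (fun i => ortho_restriction (@Fperp2_T i)).
exists (ortho Fset), (ortho Fperp), T0, T1; split.
- exists (\val : {linear ortho Fset -> H}), (\val : {linear ortho Fperp -> H}).
  split; last by move=> i x y; rewrite linearD /= T0E T1E.
  split=> // [x y|x].
    by apply: hdot_eq0C; apply: (ortho_predP _ _ (orthoP y)); exact: orthoP.
  have [y [z [yF zF ->]]] := reducing_parts x.
  by exists (Ortho yF), (Ortho zF).
- split=> [i j x|x]; apply: val_inj; first by rewrite !T0E Tcomm.
  rewrite raddf_sum /= -[RHS]defect_Fperp ?orthoP//; apply: eq_bigr => i _.
  by rewrite T0E (ortho_restriction_adjoint (@Fperp_adjoint i) (T0E i)).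
- by move=> i j x; apply: val_inj; rewrite !T1E Tcomm.
- by exists D; exact: bergman_unitary.
Qed.

End BergmanModel.

Lemma complex_eq0_Re (R : realType) (z : R[i]) :
  (forall a : R[i], Re (a * z) = 0) -> z = 0.
Proof.
case: z => x y h; apply/eqP; rewrite eq_complex /=.
have := h 1; have := h (0 +i* 1)%C => /=; rewrite !mul0r !mul1r subr0 sub0r.
by move=> /eqP; rewrite oppr_eq0 => -> ->; rewrite eqxx.
Qed.

(** * The operator identity for the Bergman shift *)

Section MzModel.
Variables (R : realType) (n m : nat).
Local Notation C := R[i].
Local Notation mi := (multiindex n).
Variables (D H : hilbertType C) (S : 'I_n -> bounded_operator H).
Variable U : {linear H -> (unit_ball R n -> D)}.
Hypotheses (m_gt0 : (0 < m)%N) (U_range : range U = Hm m)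
  (U_norm : forall x, Hm_sqnorm m (U x) = (Re `|x| ^+ 2)%:E)
  (U_S : forall i x, U (S i x) = mult_coord i (U x)).
Implicit Types (x y : H) (a b : mi) (c : mi -> D).

Let rho_gt0 a : 0 < rho R m a.
Proof. exact: rho_gt0. Qed.

Local Notation tc x := (taylor_coef (U x)).

Lemma tc_series x : power_series (U x) (tc x).
Proof.
have : Hm m (U x) by rewrite -U_range; exists x.
by move=> [[c cU] _]; rewrite (taylor_coefE cU).
Qed.

Lemma tc_summable x : norm_summable m (tc x) (rnorm x ^+ 2).
Proof. by apply: (Hm_sqnorm_summable (tc_series x)); rewrite U_norm. Qed.

Lemma rnorm_le_tc x M : norm_summable m (tc x) M -> rnorm x ^+ 2 <= M.
Proof. by move=> /(Hm_sqnorm_le (tc_series x)); rewrite U_norm lee_fin. Qed.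

Lemma tc_is_linear a : linear (fun x => tc x a).
Proof.
move=> k x y; suff -> : tc (k *: x + y) = fun a => k *: tc x a + tc y a by [].
apply: taylor_coefE; apply/power_seriesP => z; rewrite linearP.
have := has_usumP k ((power_seriesP _ _).1 (tc_series x) z)
  ((power_seriesP _ _).1 (tc_series y) z).
by apply: eq_has_usum => b; rewrite scalerDr !scalerA mulrC.
Qed.

Lemma tcD x y a : tc (x + y) a = tc x a + tc y a.
Proof. by have [g gE] := linear_pack (tc_is_linear a); rewrite -!gE linearD. Qed.

Lemma tcZ k x a : tc (k *: x) a = k *: tc x a.
Proof. by have [g gE] := linear_pack (tc_is_linear a); rewrite -!gE linearZ. Qed.

Lemma tc0 a : tc 0 a = 0.
Proof. by have [g gE] := linear_pack (tc_is_linear a); rewrite -gE linear0. Qed.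

Lemma tc_sum (I : Type) (r : seq I) (p : pred I) (f : I -> H) a :
  tc (\sum_(i <- r | p i) f i) a = \sum_(i <- r | p i) tc (f i) a.
Proof.
have [g gE] := linear_pack (tc_is_linear a); rewrite -gE linear_sum.
by apply: eq_bigr => i _; rewrite gE.
Qed.

Lemma tc_eq0 x : (forall a, tc x a = 0) -> x = 0.
Proof.
move=> h; have : rnorm x ^+ 2 <= 0.
  by apply: rnorm_le_tc => B; rewrite big1// => a _; rewrite h rnorm0 expr0n mul0r.
rewrite le_eqVlt ltNge sqr_ge0 orbF sqrf_eq0 rnorm_eq0.
by move/eqP.
Qed.

Lemma tc_inj x y : (forall a, tc x a = tc y a) -> x = y.
Proof.
move=> h; apply/eqP; rewrite -subr_eq0; apply/eqP/tc_eq0 => a.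
by rewrite tcD -scaleN1r tcZ h scaleN1r subrr.
Qed.

Lemma tc_surj c M : norm_summable m c M -> exists x, tc x = c.
Proof.
move=> cM; have [f fc] := norm_summable_series m_gt0 cM.
have : range U f by rewrite U_range; apply/HmP => //; exists c, M.
by move=> [x _ xf]; exists x; rewrite xf; exact: taylor_coefE.
Qed.

Definition single a (d : D) : mi -> D := fun b => if b == a then d else 0.

Lemma single_ex a d : exists e, tc e = single a d.
Proof.
apply: (@tc_surj _ (rnorm d ^+ 2 / rho R m a)) => B.
have t0 b : 0 <= rnorm (single a d b) ^+ 2 / rho R m b.
  by rewrite divr_ge0 ?sqr_ge0 ?ltW.
rewrite (le_trans (big_fset_le t0 (fsubsetUr [fset a]%fset B)))//.
rewrite (big_fsetD1 a) ?in_fsetU ?in_fset1 ?eqxx//= {1}/single eqxx.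
rewrite big_seq big1 ?addr0// => b; rewrite !inE => /andP[/negPf ba _].
by rewrite /single ba rnorm0 expr0n mul0r.
Qed.

(* Only the coefficient at [a] changes, so both sides are bounds for partial sums;
   applying one inequality to [x + e] and [- e] gives the other. *)
Lemma rnormD_single x e a d : tc e = single a d ->
  rnorm (x + e) ^+ 2 = rnorm x ^+ 2 + (rnorm (tc x a + d) ^+ 2 - rnorm (tc x a) ^+ 2) / rho R m a.
Proof.
have le y f d' : tc f = single a d' -> rnorm (y + f) ^+ 2 <=
    rnorm y ^+ 2 + (rnorm (tc y a + d') ^+ 2 - rnorm (tc y a) ^+ 2) / rho R m a.
  move=> fE; apply: rnorm_le_tc => B.
  have t0 z b : 0 <= rnorm (tc z b) ^+ 2 / rho R m b by rewrite divr_ge0 ?sqr_ge0 ?ltW.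
  rewrite (le_trans (big_fset_le (t0 (y + f)) (fsubsetUr [fset a]%fset B)))//.
  have := tc_summable y ([fset a] `|` B)%fset.
  have split1 z : \sum_(b <- ([fset a] `|` B)%fset) rnorm (tc z b) ^+ 2 / rho R m b =
      rnorm (tc z a) ^+ 2 / rho R m a +
      \sum_(b <- (([fset a] `|` B) `\ a)%fset) rnorm (tc z b) ^+ 2 / rho R m b.
    by rewrite (big_fsetD1 a) ?in_fsetU ?in_fset1 ?eqxx.
  have fa : tc (y + f) a = tc y a + d' by rewrite tcD fE /single eqxx.
  rewrite !split1 fa.
  rewrite (_ : \sum_(b <- (_ `\ _)%fset) rnorm (tc (y + f) b) ^+ 2 / _ =
    \sum_(b <- (([fset a] `|` B) `\ a)%fset) rnorm (tc y b) ^+ 2 / rho R m b); last first.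
    rewrite big_seq [RHS]big_seq; apply: eq_bigr => b; rewrite !inE => /andP[/negPf ba _].
    by rewrite tcD fE /single ba addr0.
  by rewrite mulrBl; lra.
move=> eE; apply/eqP; rewrite eq_le le//=.
have nE : tc (- e) = single a (- d).
  apply/funext => b; rewrite -scaleN1r tcZ eE /single scaleN1r.
  by case: eqP; rewrite ?oppr0.
have ea : tc e a = d by rewrite eE /single eqxx.
have := le (x + e) (- e) (- d) nE; rewrite addrK tcD ea addrK !mulrBl; lra.
Qed.

(** [rnormD_single] at a vector and at 0 gives the real part of the inner product by polarization;
    multiplying [x] by all scalars recovers the rest. *)
Lemma hdot_single x e a d : tc e = single a d ->
  (rho R m a)%:C%C * hdot x e = hdot (tc x a) d.
Proof.
move=> eE; have re y : rho R m a * Re (hdot y e) = Re (hdot (tc y a) d).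
  have := rnormD_single y eE; have := rnormD_single 0 eE.
  rewrite add0r tc0 add0r !rnorm0 expr0n /= add0r subr0 !rnormD_sq => -> h.
  have {}h : 2 * Re (hdot y e) = 2 * Re (hdot (tc y a) d) / rho R m a.
    by move: h; rewrite mulrBl !mulrDl; lra.
  have -> : Re (hdot y e) = Re (hdot (tc y a) d) / rho R m a by lra.
  by rewrite mulrCA divff ?mulr1// gt_eqF.
apply/eqP; rewrite -subr_eq0; apply/eqP/complex_eq0_Re => k.
rewrite mulrBr mulrCA ReD ReN Re_realM -!hdotZl -tcZ re subrr//.
Qed.

Lemma tc_S i x a : tc (S i x) a = if a i is 0%N then 0 else tc x (esub i a).
Proof. by rewrite U_S (taylor_coefE (power_series_shift i (tc_series x))). Qed.

Lemma tc_adjoint i x a :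
  tc (adjoint (S i) x) a = (rho R m a / rho R m (eadd i a))%:C%C *: tc x (eadd i a).
Proof.
apply: hdot_ext => d; have [e eE] := single_ex a d.
rewrite -(hdot_single _ eE) -adjointPr.
have SE : tc (S i e) = single (eadd i a) d.
  apply/funext => b; rewrite tc_S eE /single; case bi : (b i) => [|k].
    by case: eqP => // ba; have := eadd_gt0 i a; rewrite -ba bi.
  by rewrite -[in RHS](@esubK _ i b) ?bi// (inj_eq (@eadd_inj _ i)).
rewrite hdotZl -(hdot_single x SE) mulrA -rmorphM divfK// gt_eqF//.
Qed.

Definition diagonal (X : H -> H) (q : nat -> C) :=
  forall x a, tc (X x) a = q (deg a) *: tc x a.

(** [S_i^*] passes to degree [k - 1], and the quotient comes from [sum_rho_esub]. Degree 0 gets 0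
    because the shifts produce no constant term. *)
Definition sigma_weight (q : nat -> C) k : C :=
  if k is k'.+1 then q k' * ((nbin m k')%:R / (nbin m k)%:R) else 0.

Lemma sigma_diagonal X q : diagonal X q -> diagonal (sigma S X) (sigma_weight q).
Proof.
move=> Xq x a; rewrite tc_sum.
transitivity (\sum_(i | (0 < a i)%N)
    (q (deg a).-1 * (rho R m (esub i a) / rho R m a)%:C%C) *: tc x a).
  rewrite [RHS]big_mkcond; apply: eq_bigr => i _; rewrite tc_S.
  case ai : (a i) => [//|k]; have ai0 : (0 < a i)%N by rewrite ai.
  rewrite Xq tc_adjoint esubK// scalerA; congr (q _ * _ *: _).
  by have := deg_eadd i (esub i a); rewrite esubK// => ->.
rewrite -scaler_suml; congr (_ *: _).
case ak : (deg a) => [|k] /=.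
  by rewrite big1// => i; rewrite (deg_eq0 ak) ffunE.
rewrite -mulr_sumr -rmorph_sum -mulr_suml; congr (_ * _).
have nz : (nbin m k.+1)%:R != 0 :> R by rewrite pnatr_eq0 -lt0n nbin_gt0.
have -> : \sum_(i | (0 < a i)%N) rho R m (esub i a) =
    (nbin m k)%:R / (nbin m k.+1)%:R * rho R m a.
  apply: (mulfI nz); rewrite (sum_rho_esub R m_gt0 ak); field.
  exact: nz.
rewrite mulfK ?gt_eqF//.
by rewrite fmorph_div !rmorph_nat.
Qed.

(** Pascal's rule [nbinS] turns the difference of weights into the next one. At [l = m] they are 1
    in degree 0 and 0 above: the projection onto the constants. *)
Lemma defect_diagonal l : (l <= m)%N ->
  diagonal (defect S l) (fun k => (nbin (m - l) k)%:R / (nbin m k)%:R).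
Proof.
elim: l => [|l IH] lm x a.
  by rewrite subn0 divff ?scale1r// pnatr_eq0 -lt0n nbin_gt0.
rewrite /= tcD -scaleN1r tcZ scaleN1r (IH (ltnW lm)) (sigma_diagonal (IH (ltnW lm))).
rewrite -scalerBl; congr (_ *: _).
have nz k : (nbin m k)%:R != 0 :> C by rewrite pnatr_eq0 -lt0n nbin_gt0.
case: (deg a) => [|k] /=; first by rewrite !nbin0 subr0.
rewrite -(subnSK lm) nbinS natrD; field.
by rewrite !nz.
Qed.

Lemma adjoint_defect0 i x : adjoint (S i) (defect S m x) = 0.
Proof.
apply: tc_eq0 => a; rewrite tc_adjoint (defect_diagonal (leqnn m)) deg_eadd subnn nbin0S.
by rewrite mul0r scale0r scaler0.
Qed.

Lemma delta_diagonal : exists q K, [/\ diagonal (delta S m) q & forall k, Re `|q k| <= K].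
Proof.
pose s j := iter j sigma_weight (fun=> 1).
have sE j : diagonal (iter j (sigma S) idfun) (s j).
  elim: j => [|j IH] /=; first by move=> x a; rewrite scale1r.
  exact: sigma_diagonal.
have s1 j k : `|s j k| <= 1.
  elim: j k => [|j IH] k; first by rewrite normr1.
  rewrite /s /= -/(s j); case: k => [|k] /=; first by rewrite normr0.
  rewrite normrM mulr_ile1//.
  rewrite ger0_norm ?divr_ge0// ler_pdivrMr ?ltr0n ?nbin_gt0// mul1r ler_nat.
  by case: m m_gt0 => // p _; rewrite nbinS leq_addl.
pose g j : C := (-1) ^+ j * 'C(m, j.+1)%:R.
exists (fun k => \sum_(j < m) g j * s j k), (Re (\sum_(j < m) `|g j|)); split.
  move=> x a; rewrite tc_sum scaler_suml; apply: eq_bigr => j _.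
  by rewrite tcZ sE scalerA.
move=> k; have : `|\sum_(j < m) g j * s j k| <= \sum_(j < m) `|g j|.
  rewrite (le_trans (ler_norm_sum _ _ _))// ler_sum// => j _.
  by rewrite normrM ler_piMr.
by rewrite lecE => /andP[].
Qed.

(** Since [S_i^*] lowers the degree by one, the weight [q k] applied after it becomes a weight in
    degree [k+1] applied before it. The constant term of [y] is free and set to 0; boundedness of
    [q] makes [y] exist. *)
Lemma delta_adjoint_range x : exists y, forall i,
  delta S m (adjoint (S i) x) = adjoint (S i) y.
Proof.
have [q [K [qE qK]]] := delta_diagonal.
pose c a : D := if deg a is k.+1 then q k *: tc x a else 0.
have K0 : 0 <= K by rewrite (le_trans (Re_norm_ge0 _) (qK 0%N)).
have [|y yE] := @tc_surj c (K ^+ 2 * rnorm x ^+ 2).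
  move=> B; apply: le_trans (ler_wpM2l (sqr_ge0 K) (tc_summable x B)).
  rewrite mulr_sumr ler_sum// => a _; rewrite mulrA ler_pM2r ?invr_gt0//.
  rewrite /c; case: (deg a) => [|k].
    by rewrite rnorm0 expr0n mulr_ge0 ?sqr_ge0.
  rewrite rnormZ exprMn ler_wpM2r ?sqr_ge0// ler_pXn2r ?nnegrE ?Re_norm_ge0//.
exists y => i; apply: tc_inj => a.
rewrite qE !tc_adjoint yE /c deg_eadd !scalerA; congr (_ *: _); exact: mulrC.
Qed.

End MzModel.

(** * The spherical summand *)

Section SphericalCoisometry.
Variables (R : realType) (n : nat) (H : hilbertType R[i]).
Variable S : 'I_n -> bounded_operator H.
Hypothesis Ssph : forall x, \sum_i S i (adjoint (S i) x) = x.

Lemma spherical_defect l x : defect S l.+1 x = 0.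
Proof.
elim: l x => [|l IH] x; first by rewrite /= /sigma Ssph subrr.
rewrite -[defect S l.+2 x]/(defect S l.+1 x - sigma S (defect S l.+1) x) IH sub0r.
by rewrite /sigma big1 ?oppr0// => i _; rewrite IH linear0.
Qed.

(** Every [sigma^j(1)] is the identity, so [delta] is a scalar [k]; that [k] acts as 1 is read off
    from [0 = defect = 1 - sigma(delta)] rather than from the alternating binomial sum. *)
Lemma spherical_delta m x : (0 < m)%N -> delta S m x = x.
Proof.
case: m => // m _; pose k : R[i] := \sum_(j < m.+1) (-1) ^+ j * 'C(m.+1, j.+1)%:R.
have itE j y : iter j (sigma S) idfun y = y.
  elim: j y => //= j IH y; rewrite -[RHS]Ssph; apply: eq_bigr => i _.
  by rewrite IH.
have dE y : delta S m.+1 y = k *: y.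
  by rewrite /delta scaler_suml; apply: eq_bigr => j _; rewrite itE.
have := defect_delta S m.+1 x; rewrite spherical_defect => /esym/eqP.
rewrite subr_eq0 => /eqP {2}->; rewrite dE /sigma.
under eq_bigr do rewrite dE linearZ.
by rewrite -scaler_sumr Ssph.
Qed.

End SphericalCoisometry.

(** * Orthogonal direct sums and the equivalence *)

Section DirectSum.
Variables (R : realType) (n : nat).
Local Notation C := R[i].
Variables (H H0 H1 : hilbertType C) (T : 'I_n -> bounded_operator H).
Variables (T0 : 'I_n -> bounded_operator H0) (T1 : 'I_n -> bounded_operator H1).
Variables (J0 : {linear H0 -> H}) (J1 : {linear H1 -> H}).
Hypothesis J : orthogonal_direct_sum J0 J1.
Hypothesis TJ : forall i x y, T i (J0 x + J1 y) = J0 (T0 i x) + J1 (T1 i y).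

Lemma hdot_sum x y x' y' :
  hdot (J0 x + J1 y) (J0 x' + J1 y') = hdot x x' + hdot y y'.
Proof.
have [h0 h1 h01 _] := J.
by rewrite hdotDl !hdotDr h0 h1 h01 (hdot_eq0C (h01 _ _)) addr0 add0r.
Qed.

Lemma adjoint_sum i x y :
  adjoint (T i) (J0 x + J1 y) = J0 (adjoint (T0 i) x) + J1 (adjoint (T1 i) y).
Proof.
have [_ _ _ h] := J; apply: adjoint_eq => u; have [x' [y' ->]] := h u.
by rewrite TJ !hdot_sum !adjointP.
Qed.

Lemma sigma_sum X X0 X1 :
  (forall x y, X (J0 x + J1 y) = J0 (X0 x) + J1 (X1 y)) ->
  forall x y, sigma T X (J0 x + J1 y) = J0 (sigma T0 X0 x) + J1 (sigma T1 X1 y).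
Proof.
move=> XJ x y; rewrite /sigma !linear_sum -big_split; apply: eq_bigr => i _ /=.
by rewrite adjoint_sum XJ TJ.
Qed.

Lemma delta_sum m x y : delta T m (J0 x + J1 y) = J0 (delta T0 m x) + J1 (delta T1 m y).
Proof.
rewrite /delta !linear_sum -big_split; apply: eq_bigr => j _ /=.
rewrite !linearZ -scalerDr; congr (_ *: _).
by elim: {j}(j : nat) x y => // j IH x y; exact: sigma_sum.
Qed.

Lemma defect_sum l x y : defect T l (J0 x + J1 y) = J0 (defect T0 l x) + J1 (defect T1 l y).
Proof.
elim: l x y => // l IH x y; rewrite /= IH (sigma_sum IH) !linearB.
by rewrite opprD addrACA.
Qed.

End DirectSum.

(** It is enough to write [delta T^*h] as [T^*h']: since [T^*] kills [defect T m h],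
    [T^*h = T^* sigma(delta) h = T^*T T^*h'], and [inv_TstarTK] returns [T^*h']. *)
Lemma operator_identity_direct_sum (R : realType) (m n : nat) (H H0 H1 D : hilbertType R[i])
    (T : 'I_n -> bounded_operator H)
    (T0 : 'I_n -> bounded_operator H0) (T1 : 'I_n -> bounded_operator H1) :
  (0 < m)%N -> tuple_direct_sum T T0 T1 -> spherical_coisometry T0 ->
  unitarily_equivalent_Mz D m T1 -> operator_identity m T.
Proof.
move=> m0 [J0 [J1 [J TJ]]] [_ sph] [U [Ur Un US]] v [h _ <-].
have [_ _ _ /(_ h) [x [y hE]]] := J.
have [y' y'E] := delta_adjoint_range m0 Ur Un US y.
pose h' := J0 x + J1 y'.
have dE i : delta T m (adjoint (T i) h) = adjoint (T i) h'.
  by rewrite hE /h' !(adjoint_sum J TJ) (delta_sum J TJ) spherical_delta// y'E.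
have d0 i : adjoint (T i) (defect T m h) = 0.
  rewrite hE (defect_sum J TJ) (adjoint_sum J TJ) (adjoint_defect0 m0 Ur Un US).
  by case: m m0 {Ur Un y'E dE h'} => // p _; rewrite spherical_defect// !linear0 addr0.
have hS : row_adj T h = row_adj T (row_op T (row_adj T h')).
  apply/ffunP => i; rewrite !ffunE; have := d0 i; rewrite defect_delta linearB => /eqP.
  rewrite subr_eq0 => /eqP ->; congr (adjoint _ _).
  by apply: eq_bigr => j _; rewrite ffunE dE.
rewrite {1}hS inv_TstarTK; apply/ffunP => i; rewrite !ffunE -dE.
by [].
Qed.

Theorem theorem10 (R : realType) (m n : nat) (hm : (1 <= m)%N) (hn : (1 <= n)%N)
    (H : hilbertType R[i]) (T : 'I_n -> bounded_operator H)
    (Tcomm : commuting T) (Tcontr : row_contraction T) (Treg : regular_at0 T) :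
  operator_identity m T <->
  exists (H0 H1 : hilbertType R[i])
         (T0 : 'I_n -> bounded_operator H0) (T1 : 'I_n -> bounded_operator H1),
    [/\ tuple_direct_sum T T0 T1,
        spherical_coisometry T0,
        commuting T1
      & exists D : hilbertType R[i], unitarily_equivalent_Mz D m T1].
Proof.
split=> [opid|[H0 [H1 [T0 [T1 [TE T0sph _ [D T1E]]]]]]]; last first.
  exact: operator_identity_direct_sum TE T0sph T1E.
have Tid := operator_identity_adjoint opid.
apply: bergman_decomposition => // [x|w i b /in_WP Ww].
  by apply/in_WP; exact: defect_in_W.
exact: adjoint_mpow.
Qed.
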